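(* Let $\theta\in[0,\pi)\setminus\{\pi/2\}$, $\kappa(\theta):=\gamma-\log2+\tan\theta$, and let $K_\theta(t):=\lim_{R\to\infty}\frac{1}{2\pi i}\int_{-iR}^{iR}e^{t\zeta}(\log\sqrt\zeta+\kappa(\theta))^{-1}d\zeta$. Define $$\mathrm{Tr}_1\big(N'E_+*_tK_\theta*_tN'E_+\big)(t):=\int_0^1\int_0^t\int_0^{s}N'E_+(x,t-s)\,K_\theta(s-r)\,N'E_+(x,r)\,dr\,ds\,dx.$$ Then there exist constants $b_j$, $j\ge0$, such that for every $N\in\mathbb N$, as $t\to0^+$, $$\mathrm{Tr}_1\big(N'E_+*_tK_\theta*_tN'E_+\big)(t)=\sum_{j=0}^{N-1}b_jt^j+\frac1\pi\,\mathrm{Im}\left(\int_1^\infty\frac{e^{-ty}}{y}\big(\log y+i\pi+2\kappa(\theta)\big)^{-1}dy\right)+O(t^N).$$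
   Context: $N'E_+(x,t):=\frac{\sqrt x}{2t}\exp(-\frac{x^2}{4t})$ for $x,t>0$; $\gamma$ is the Euler–Mascheroni constant; $\sqrt\zeta$ and $\log$ denote principal branches on $\mathbb C\setminus(-\infty,0]$, continued to the imaginary axis away from $0$. *)

(* Defs.v *)
From Stdlib Require Import Reals Lra.
Open Scope R_scope.

Definition Cplx : Type := (R * R)%type.
Definition RtoC (a : R) : Cplx := (a, 0).
Definition Ci : Cplx := (0, 1).
Definition Cadd (z w : Cplx) : Cplx := (fst z + fst w, snd z + snd w).
Definition Csub (z w : Cplx) : Cplx := (fst z - fst w, snd z - snd w).
Definition Cmul (z w : Cplx) : Cplx :=
  (fst z * fst w - snd z * snd w, fst z * snd w + snd z * fst w).
Definition Cinv (z : Cplx) : Cplx :=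
  let d := fst z * fst z + snd z * snd z in (fst z / d, - snd z / d).
Definition Cmod (z : Cplx) : R := sqrt (fst z * fst z + snd z * snd z).
Definition Cexp (z : Cplx) : Cplx := (exp (fst z) * cos (snd z), exp (fst z) * sin (snd z)).

(* principal argument, in (-PI, PI] (0 at the origin) *)
Definition Carg (z : Cplx) : R :=
  let a := fst z in let b := snd z in
  match Rlt_dec 0 a with
  | left _ => atan (b / a)
  | right _ =>
    match Rlt_dec a 0 with
    | left _ => match Rle_dec 0 b with
                | left _ => atan (b / a) + PI
                | right _ => atan (b / a) - PI
                end
    | right _ =>
      match Rlt_dec 0 b with
      | left _ => PI / 2
      | right _ => match Rlt_dec b 0 with
                   | left _ => - (PI / 2)
                   | right _ => 0
                   end
      end
    end
  end.

Definition Clog (z : Cplx) : Cplx := (ln (Cmod z), Carg z).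
Definition Csqrt (z : Cplx) : Cplx :=
  (sqrt (Cmod z) * cos (Carg z / 2), sqrt (Cmod z) * sin (Carg z / 2)).

Definition is_RInt (f : R -> R) (a b v : R) : Prop :=
  exists pr : Riemann_integrable f a b, RiemannInt pr = v.

Definition is_CInt (f : R -> Cplx) (a b : R) (v : Cplx) : Prop :=
  is_RInt (fun x => fst (f x)) a b (fst v) /\ is_RInt (fun x => snd (f x)) a b (snd v).

Definition is_CInt_open (f : R -> Cplx) (a b : R) (v : Cplx) : Prop :=
  forall eps, 0 < eps -> exists del, 0 < del /\
    forall a' b', a < a' < a + del -> b - del < b' < b ->
      exists w, is_CInt f a' b' w /\ Cmod (Csub w v) < eps.

Definition is_CInt_infty (f : R -> Cplx) (a : R) (v : Cplx) : Prop :=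
  forall eps, 0 < eps -> exists M, forall b, M < b ->
      exists w, is_CInt f a b w /\ Cmod (Csub w v) < eps.

Definition NEp (x t : R) : R := sqrt x / (2 * t) * exp (- (x ^ 2) / (4 * t)).

Definition kappa (gam theta : R) : R := gam - ln 2 + tan theta.

(* integrand of (1/(2 pi i)) int_{-iR}^{iR} e^{t zeta} (log sqrt zeta + kappa)^{-1} d zeta,
   parametrized by zeta = i y, d zeta = i dy *)
Definition K_integrand (kap t y : R) : Cplx :=
  let zeta := (0, y) in
  Cmul (Cinv (Cmul (RtoC (2 * PI)) Ci))
    (Cmul (Cexp (Cmul (RtoC t) zeta))
      (Cmul (Cinv (Cadd (Clog (Csqrt zeta)) (RtoC kap))) Ci)).

Definition K_lim (kap t : R) (v : Cplx) : Prop :=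
  forall eps, 0 < eps -> exists R0, forall Rr, R0 < Rr ->
    exists w, is_CInt (K_integrand kap t) (- Rr) Rr w /\ Cmod (Csub w v) < eps.

Definition Tr1_is (K : R -> Cplx) (t : R) (T : Cplx) : Prop :=
  exists (g : R -> R -> Cplx) (h : R -> Cplx),
    (forall x s, 0 < x < 1 -> 0 < s < t ->
       is_CInt_open (fun r => Cmul (RtoC (NEp x (t - s) * NEp x r)) (K (s - r))) 0 s (g x s)) /\
    (forall x, 0 < x < 1 -> is_CInt_open (g x) 0 t (h x)) /\
    is_CInt_open h 0 1 T.

Definition J_integrand (kap t y : R) : Cplx :=
  Cmul (RtoC (exp (- (t * y)) / y))
       (Cinv (Cadd (Cadd (Clog (RtoC y)) (Cmul Ci (RtoC PI))) (RtoC (2 * kap)))).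

Fixpoint psum (b : nat -> Cplx) (t : R) (N : nat) : Cplx :=
  match N with
  | O => RtoC 0
  | S n => Cadd (psum b t n) (Cmul (b n) (RtoC (t ^ n)))
  end.

Fixpoint harm (n : nat) : R :=
  match n with O => 0 | S m => harm m + / INR (S m) end.

(* Main.v *)
(** With [w y = 1 / ((ln y + 2 kappa)^2 + PI^2)], rotating the contour onto the two sides of the
    negative axis gives [K s = 2 int_0^oo exp (- s y) w y dy >= 0].  Since
    [int_0^oo NEp x a * NEp x b dx = 1 / (2 (a + b))], and cutting the integral at [x = 1] costs a
    factor [1 - exp (- (a + b) / (4 a b))], the trace is [M t / 2] up to [O (exp (- 1 / t))], where
    [M t = int_0^t K = 2 int_0^oo (1 - exp (- t y)) / y * w y dy].  The part [y > 1] of the latter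
    is a constant plus the imaginary part of the integral in the statement, and the part [y < 1]
    is an entire function of [t].

    [K] is singular at [0], so all convolutions with [K] are integrated by parts and become proper
    integrals of the continuous function [M]; associativity of convolution is then Fubini's theorem
    for continuous functions.  By the scaling [NEp x r = x^(-3/2) e (r / x^2)], the convolution
    [NEp x * NEp x] is [1 / x * (e * e) (c / x^2)], and this has an explicit primitive in [x]. *)

(* The factor 2 in [K] comes from [log (sqrt zeta) + kappa = (log zeta + 2 kappa) / 2]. On the
   imaginary axis the integrand decays only like [1 / ln R], so the contour integral converges
   conditionally and each arc needs an explicit bound in [R]. The rotation stays in the left half
   plane, away from the pole [zeta = exp (- 2 kappa)] on the positive axis.

   Integrability of [K] at [0] amounts to that of [w y / y] at infinity, whose primitive
   [atan ((ln y + 2 kappa) / PI) / PI] tends to [1 / 2]. The same tail bounds the error of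
   truncating [M] at [y = R], uniformly in [t], so [M] is continuous up to [0]; the truncations of
   [K] are controlled only for [t] away from [0].

   The [x]-integral is improper at [x = 0], where the kernels degenerate. Its primitive at [x] is an
   integral of [M (t - c)] against a distribution function in [c] that lies between [0] and [1 / 2]
   and tends to [1 / 2] as [x -> 0]. Since [K >= 0], bounds on this function, without any on its
   density, give the limit [M t / 2]. *)
From Stdlib Require Import Reals Lra Lia Factorial.
From Coquelicot Require Import Rbar Hierarchy Rcomplements Lim_seq Continuity Derive RInt RInt_analysis ElemFct AutoDerive Derive_2d.
Require Import Defs.
Open Scope R_scope.

(** * Riemann integrals of continuous functions *)

(* Coquelicot leaves equations at carriers that are only convertible to [R]; [ring] rejects these. *)
Ltac rring := lazymatch goal with |- @eq _ ?a ?b => change (@eq R a b) end; unfold Rdiv; ring.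

Section Cont.
Context {U : UniformSpace}.
Implicit Types (f g : U -> R) (x : U).

Lemma cont_plus f g x : continuous f x -> continuous g x -> continuous (fun z => f z + g z) x.
Proof. apply (continuous_plus f g). Qed.

Lemma cont_minus f g x : continuous f x -> continuous g x -> continuous (fun z => f z - g z) x.
Proof. apply (continuous_minus f g). Qed.

Lemma cont_opp f x : continuous f x -> continuous (fun z => - f z) x.
Proof. apply (continuous_opp f). Qed.

Lemma cont_mult f g x : continuous f x -> continuous g x -> continuous (fun z => f z * g z) x.
Proof. apply (continuous_mult f g). Qed.

Lemma cont_comp (h : R -> R) f x :
  continuous f x -> continuous h (f x) -> continuous (fun z => h (f z)) x.
Proof. apply (continuous_comp f h). Qed.

Lemma cont_inv f x : f x <> 0 -> continuous f x -> continuous (fun z => / f z) x.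
Proof.
  intros H C; apply cont_comp; auto.
  apply (ex_derive_continuous (K := R_AbsRing) (V := R_NormedModule)); auto_derive; auto.
Qed.

Lemma cont_div f g x : g x <> 0 -> continuous f x -> continuous g x -> continuous (fun z => f z / g z) x.
Proof. intros; apply cont_mult; auto; apply cont_inv; auto. Qed.

Lemma cont_pow f n x : continuous f x -> continuous (fun z => f z ^ n) x.
Proof.
  intros C; induction n as [|n IH]; simpl.
  - apply continuous_const.
  - apply cont_mult; auto.
Qed.

Lemma cont_exp f x : continuous f x -> continuous (fun z => exp (f z)) x.
Proof.
  intros C; apply cont_comp; auto.
  apply (ex_derive_continuous (K := R_AbsRing) (V := R_NormedModule)); auto_derive; auto.
Qed.

Lemma cont_cos f x : continuous f x -> continuous (fun z => cos (f z)) x.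
Proof.
  intros C; apply cont_comp; auto.
  apply (ex_derive_continuous (K := R_AbsRing) (V := R_NormedModule)); auto_derive; auto.
Qed.

Lemma cont_sin f x : continuous f x -> continuous (fun z => sin (f z)) x.
Proof.
  intros C; apply cont_comp; auto.
  apply (ex_derive_continuous (K := R_AbsRing) (V := R_NormedModule)); auto_derive; auto.
Qed.

Lemma cont_ln f x : 0 < f x -> continuous f x -> continuous (fun z => ln (f z)) x.
Proof.
  intros H C; apply cont_comp; auto.
  apply (ex_derive_continuous (K := R_AbsRing) (V := R_NormedModule)); auto_derive; auto.
Qed.

End Cont.

Lemma cont_fst (p : R * R) : continuous (fun z : R * R => fst z) p.
Proof. destruct p; apply continuous_fst. Qed.

Lemma cont_snd (p : R * R) : continuous (fun z : R * R => snd z) p.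
Proof. destruct p; apply continuous_snd. Qed.

(** The heads [Ropp], [exp], [Rminus c] and the like are eta-reduced bodies. What [cont] leaves open
    are nonzero denominators, positive arguments of [ln] and the continuity of unknown functions. *)
Ltac cont_step :=
  lazymatch goal with
  | |- continuous (fun _ => ?c) _ => apply continuous_const
  | |- continuous fst _ => apply cont_fst
  | |- continuous snd _ => apply cont_snd
  | |- continuous Ropp _ => apply (cont_opp (fun z => z))
  | |- continuous exp _ => apply (cont_exp (fun z => z))
  | |- continuous (Rminus ?c) _ => apply (cont_minus (fun _ => c) (fun z => z))
  | |- continuous (Rplus ?c) _ => apply (cont_plus (fun _ => c) (fun z => z))
  | |- continuous (Rmult ?c) _ => apply (cont_mult (fun _ => c) (fun z => z))
  | |- continuous (fun z => z) _ => apply continuous_id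
  | |- continuous (fun z => fst z) _ => apply cont_fst
  | |- continuous (fun z => snd z) _ => apply cont_snd
  | |- continuous (fun z => @?f z + @?g z) _ => apply (cont_plus f g)
  | |- continuous (fun z => @?f z - @?g z) _ => apply (cont_minus f g)
  | |- continuous (fun z => - @?f z) _ => apply (cont_opp f)
  | |- continuous (fun z => @?f z / @?g z) _ => apply (cont_div f g)
  | |- continuous (fun z => @?f z * @?g z) _ => apply (cont_mult f g)
  | |- continuous (fun z => / @?f z) _ => apply (cont_inv f)
  | |- continuous (fun z => @?f z ^ ?n) _ => apply (cont_pow f n)
  | |- continuous (fun z => exp (@?f z)) _ => apply (cont_exp f)
  | |- continuous (fun z => cos (@?f z)) _ => apply (cont_cos f)
  | |- continuous (fun z => sin (@?f z)) _ => apply (cont_sin f)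
  | |- continuous (fun z => ln (@?f z)) _ => apply (cont_ln f)
  end.
Ltac cont := cbv beta; repeat (cont_step; cbv beta; try assumption); auto.

Lemma cont_deriv (f : R -> R) x l : is_derive f x l -> continuous f x.
Proof. intros D; apply (ex_derive_continuous (V := R_NormedModule)); exists l; exact D. Qed.

Lemma cont_eps (f : R -> R) x :
  continuous f x <->
  forall eps, 0 < eps -> exists del, 0 < del /\
    forall y, Rabs (y - x) < del -> Rabs (f y - f x) < eps.
Proof.
  split.
  - intros C eps He.
    destruct (proj1 (filterlim_locally f (f x)) C (mkposreal eps He)) as [d Hd].
    exists d; split; [apply cond_pos|]; intros y Hy; exact (Hd y Hy).
  - intros H; apply filterlim_locally; intros [eps He].
    destruct (H eps He) as [d [Hd H']].
    exists (mkposreal d Hd); intros y Hy; exact (H' y Hy).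
Qed.

Lemma ex_RInt_cont_minmax (f : R -> R) a b :
  (forall x, Rmin a b <= x <= Rmax a b -> continuous f x) -> ex_RInt f a b.
Proof. apply (ex_RInt_continuous (V := R_CompleteNormedModule)). Qed.

Lemma ex_RInt_cont (f : R -> R) a b : (forall x, continuous f x) -> ex_RInt f a b.
Proof. intros; apply ex_RInt_cont_minmax; auto. Qed.

Lemma ex_RInt_cont_on (f : R -> R) a b : a <= b ->
  (forall x, a <= x <= b -> continuous f x) -> ex_RInt f a b.
Proof. intros L C; apply ex_RInt_cont_minmax; rewrite Rmin_left, Rmax_right; auto. Qed.

Lemma RInt_ext_on (f g : R -> R) a b : a <= b ->
  (forall x, a < x < b -> f x = g x) -> RInt f a b = RInt g a b.
Proof. intros L H; apply RInt_ext; rewrite Rmin_left, Rmax_right; auto. Qed.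

Lemma ex_RInt_ext_on (f g : R -> R) a b : a <= b ->
  (forall x, a < x < b -> f x = g x) -> ex_RInt f a b -> ex_RInt g a b.
Proof. intros L H; apply ex_RInt_ext; rewrite Rmin_left, Rmax_right; auto. Qed.

Lemma RInt_Rplus (f g : R -> R) a b : ex_RInt f a b -> ex_RInt g a b ->
  RInt (fun x => f x + g x) a b = RInt f a b + RInt g a b.
Proof. apply (RInt_plus (V := R_CompleteNormedModule)). Qed.

Lemma RInt_Rminus (f g : R -> R) a b : ex_RInt f a b -> ex_RInt g a b ->
  RInt (fun x => f x - g x) a b = RInt f a b - RInt g a b.
Proof. apply (RInt_minus (V := R_CompleteNormedModule)). Qed.

Lemma RInt_Rscal (f : R -> R) a b l : ex_RInt f a b ->
  RInt (fun x => l * f x) a b = l * RInt f a b.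
Proof. apply (RInt_scal (V := R_CompleteNormedModule)). Qed.

Lemma ex_RInt_Rminus (f g : R -> R) a b : ex_RInt f a b -> ex_RInt g a b ->
  ex_RInt (fun x => f x - g x) a b.
Proof. apply (ex_RInt_minus (V := R_NormedModule)). Qed.

Lemma ex_RInt_Rscal (f : R -> R) a b l : ex_RInt f a b ->
  ex_RInt (fun x => l * f x) a b.
Proof. apply (ex_RInt_scal (V := R_NormedModule)). Qed.

Lemma RInt_split (f : R -> R) a b c : ex_RInt f a b -> ex_RInt f b c ->
  RInt f a c = RInt f a b + RInt f b c.
Proof. intros H1 H2; symmetry; apply (RInt_Chasles (V := R_CompleteNormedModule)); auto. Qed.

Lemma RInt_Rconst c a b : RInt (fun _ => c) a b = (b - a) * c.
Proof. apply (RInt_const (V := R_CompleteNormedModule)). Qed.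

Lemma RInt_Rpoint (f : R -> R) a : RInt f a a = 0.
Proof. apply (RInt_point (V := R_CompleteNormedModule)). Qed.

Lemma RInt_FTC (f df : R -> R) a b : a <= b ->
  (forall x, a <= x <= b -> is_derive f x (df x)) ->
  (forall x, a <= x <= b -> continuous df x) ->
  RInt df a b = f b - f a.
Proof.
  intros L D C; apply is_RInt_unique.
  apply (is_RInt_derive (V := R_CompleteNormedModule) f df);
    rewrite Rmin_left, Rmax_right; auto.
Qed.

Lemma is_derive_RInt_upper (f : R -> R) a x : (forall y, continuous f y) ->
  is_derive (fun z => RInt f a z) x (f x).
Proof.
  intros C; apply (is_derive_RInt (V := R_NormedModule) f _ a).
  - exists (mkposreal 1 Rlt_0_1); intros y _.
    apply (RInt_correct (V := R_CompleteNormedModule)), ex_RInt_cont; auto.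
  - apply C.
Qed.

Lemma cont_RInt_upper (f : R -> R) a x : (forall y, continuous f y) ->
  continuous (fun z => RInt f a z) x.
Proof. intros C; apply (cont_deriv _ _ (f x)), is_derive_RInt_upper, C. Qed.

Lemma RInt_nonneg (f : R -> R) a b : a <= b -> ex_RInt f a b ->
  (forall x, a < x < b -> 0 <= f x) -> 0 <= RInt f a b.
Proof.
  intros L E H; rewrite <- (Rmult_0_r (b - a)), <- (RInt_Rconst 0).
  apply RInt_le; auto. apply (ex_RInt_const (V := R_NormedModule)).
Qed.

Lemma RInt_abs_le (f g : R -> R) a b : a <= b -> ex_RInt f a b -> ex_RInt g a b ->
  (forall x, a < x < b -> Rabs (f x) <= g x) -> Rabs (RInt f a b) <= RInt g a b.
Proof.
  intros L E1 E2 H; apply Rabs_le; split.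
  - rewrite <- (Rmult_1_l (RInt g a b)), Ropp_mult_distr_l, <- RInt_Rscal by auto.
    apply RInt_le; auto using ex_RInt_Rscal.
    intros x Hx; generalize (H x Hx); intros H1; apply Rabs_le_between in H1; lra.
  - apply RInt_le; auto.
    intros x Hx; generalize (H x Hx); intros H1; apply Rabs_le_between in H1; lra.
Qed.

Lemma RInt_abs_le_const (f : R -> R) a b c : a <= b -> ex_RInt f a b ->
  (forall x, a < x < b -> Rabs (f x) <= c) -> Rabs (RInt f a b) <= (b - a) * c.
Proof.
  intros L E H; rewrite <- RInt_Rconst; apply RInt_abs_le; auto.
  apply (ex_RInt_const (V := R_NormedModule)).
Qed.

Lemma RInt_affine (f : R -> R) u v a b : (forall x, continuous f x) ->
  RInt (fun y => u * f (u * y + v)) a b = RInt f (u * a + v) (u * b + v).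
Proof. intros C; apply (RInt_comp_lin (V := R_CompleteNormedModule)), ex_RInt_cont, C. Qed.

Lemma RInt_Rswap (f : R -> R) a b : (forall x, continuous f x) -> RInt f b a = - RInt f a b.
Proof.
  intros C; symmetry; apply (opp_RInt_swap (V := R_CompleteNormedModule)), ex_RInt_cont, C.
Qed.

Lemma RInt_reflect (f : R -> R) c : (forall x, continuous f x) ->
  RInt (fun y => f (c - y)) 0 c = RInt f 0 c.
Proof.
  intros C.
  assert (H := RInt_affine f (-1) c 0 c C).
  replace (-1 * 0 + c) with c in H by ring.
  replace (-1 * c + c) with 0 in H by ring.
  rewrite (RInt_Rswap f 0 c C), RInt_Rscal in H.
  - rewrite (RInt_ext (fun y => f (c - y)) (fun y => f (-1 * y + c)))
      by (intros; f_equal; ring).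
    lra.
  - apply ex_RInt_cont; intros x; apply (cont_comp f); auto; cont.
Qed.

(** Composing with this retraction onto [[a, b]] turns continuity on a rectangle into continuity on
    the plane and leaves integrals over the rectangle unchanged. *)
Definition clamp a b x := Rmax a (Rmin b x).

Lemma clamp_in a b x : a <= b -> a <= clamp a b x <= b.
Proof. intros L; unfold clamp, Rmax, Rmin; repeat destruct Rle_dec; lra. Qed.

Lemma clamp_id a b x : a <= x <= b -> clamp a b x = x.
Proof. intros L; unfold clamp, Rmax, Rmin; repeat destruct Rle_dec; lra. Qed.

Lemma clamp_cont a b x : a <= b -> continuous (clamp a b) x.
Proof.
  intros L; apply cont_eps; intros eps He; exists eps; split; auto.
  intros y; unfold clamp, Rmax, Rmin, Rabs; repeat destruct Rle_dec; repeat destruct Rcase_abs; lra.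
Qed.

(** * Joint continuity, integrals with a parameter, Fubini *)

Definition cont2 (f : R -> R -> R) x y := continuous (fun z : R * R => f (fst z) (snd z)) (x, y).

Lemma continuity_2d_cont2 f x y : cont2 f x y -> continuity_2d_pt f x y.
Proof. intros C; apply continuity_2d_pt_filterlim; exact C. Qed.

Lemma cont2_left f x y : cont2 f x y -> continuous (fun u => f u y) x.
Proof.
  intros C; apply (continuous_comp_2 (fun u : R => u) (fun _ : R => y) f); cont; exact C.
Qed.

Lemma cont2_right f x y : cont2 f x y -> continuous (fun v => f x v) y.
Proof.
  intros C; apply (continuous_comp_2 (fun _ : R => x) (fun v : R => v) f); cont; exact C.
Qed.

Lemma cont2_swap f x y : cont2 f x y -> cont2 (fun v u => f u v) y x.
Proof.
  intros C; unfold cont2.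
  apply (continuous_comp_2 (fun z : R * R => snd z) (fun z : R * R => fst z) f); cont; exact C.
Qed.

Lemma RInt_param_cont (f : R -> R -> R) a b x0 : a <= b ->
  (forall x y, cont2 f x y) -> continuous (fun x => RInt (f x) a b) x0.
Proof.
  intros L C; apply cont_eps; intros eps He.
  (* The [+ 1] also covers [a = b]. *)
  assert (He' : 0 < eps / (b - a + 1)) by (apply Rdiv_lt_0_compat; lra).
  destruct (uniform_continuity_2d_1d' f a b x0 (fun y _ => continuity_2d_cont2 _ _ _ (C x0 y))
     (mkposreal _ He')) as [d Hd].
  exists d; split; [apply cond_pos|]; intros x Hx.
  rewrite <- RInt_Rminus by (apply ex_RInt_cont; intros; apply cont2_right, C).
  apply Rle_lt_trans with ((b - a) * (eps / (b - a + 1))).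
  - apply RInt_abs_le_const; auto.
    + apply ex_RInt_cont; intros; apply cont_minus; apply cont2_right, C.
    + intros y Hy; left.
      apply Rabs_lt_between in Hx. assert (Hp := cond_pos d).
      apply (Hd y x0 y x); try lra.
      rewrite Rminus_diag, Rabs_R0; auto.
  - apply Rmult_lt_reg_r with (b - a + 1); [lra|].
    field_simplify; lra || nra.
Qed.

Lemma RInt_param_deriv (f f' : R -> R -> R) a b x : a <= b ->
  (forall x y, is_derive (fun u => f u y) x (f' x y)) ->
  (forall x y, cont2 f' x y) -> (forall x, ex_RInt (f x) a b) ->
  is_derive (fun x => RInt (f x) a b) x (RInt (f' x) a b).
Proof.
  intros L D C E.
  assert (HD : forall u v, f' u v = Derive (fun z => f z v) u)
    by (intros; symmetry; apply is_derive_unique, D).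
  rewrite (RInt_ext (f' x) (fun y => Derive (fun z => f z y) x)) by (intros; apply HD).
  apply is_derive_RInt_param.
  - exists (mkposreal 1 Rlt_0_1); intros u _ y _; exists (f' u y); apply D.
  - intros y _; apply continuity_2d_pt_ext with f'; [exact HD|].
    apply continuity_2d_cont2, C.
  - exists (mkposreal 1 Rlt_0_1); intros u _; apply E.
Qed.

(** The iterated integral [Psi X] with inner upper bound [X] vanishes at [a], and differentiation
    under the integral sign gives its derivative [RInt (f X) c d]; the fundamental theorem of
    calculus does the rest. *)
Lemma Fubini_all (f : R -> R -> R) a b c d : a <= b -> c <= d ->
  (forall x y, cont2 f x y) ->
  RInt (fun x => RInt (fun y => f x y) c d) a b =
  RInt (fun y => RInt (fun x => f x y) a b) c d.
Proof.
  intros L1 L2 C.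
  assert (Cp : forall x, continuous (fun x => RInt (fun y => f x y) c d) x)
    by (intros; apply RInt_param_cont; auto).
  assert (Dx : forall y x, is_derive (fun z => RInt (fun u => f u y) a z) x (f x y)).
  { intros y x; apply (is_derive_RInt_upper (fun u => f u y)); intros; apply (cont2_left f), C. }
  set (Psi := fun X => RInt (fun y => RInt (fun x => f x y) a X) c d).
  assert (D : forall X, is_derive Psi X (RInt (fun y => f X y) c d)).
  { intros X; apply (RInt_param_deriv (fun X y => RInt (fun x => f x y) a X)); auto.
    intros x; apply ex_RInt_cont; intros y.
    (* [Psi] is differentiated at every [X], also below [a], whereas [RInt_param_cont] wants ordered
       bounds. *)
    destruct (Rle_or_lt a x) as [Hax|Hax].
    + apply (RInt_param_cont (fun y u => f u y)); auto.
      intros; apply cont2_swap, C.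
    + apply continuous_ext with (fun y => - RInt (fun u => f u y) x a).
      { intros z; symmetry; apply RInt_Rswap; intros; apply (cont2_left f), C. }
      apply cont_opp, (RInt_param_cont (fun y u => f u y)); try lra.
      intros; apply cont2_swap, C. }
  rewrite (RInt_FTC Psi); auto.
  unfold Psi at 2.
  rewrite (RInt_ext _ (fun _ => 0)) by (intros; apply RInt_Rpoint).
  rewrite RInt_Rconst, Rmult_0_r, Rminus_0_r; reflexivity.
Qed.

Lemma Fubini (f : R -> R -> R) a b c d : a <= b -> c <= d ->
  (forall x y, a <= x <= b -> c <= y <= d -> cont2 f x y) ->
  RInt (fun x => RInt (fun y => f x y) c d) a b =
  RInt (fun y => RInt (fun x => f x y) a b) c d.
Proof.
  intros L1 L2 C.
  assert (H := Fubini_all (fun x y => f (clamp a b x) (clamp c d y)) a b c d L1 L2).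
  erewrite RInt_ext_on; [erewrite (RInt_ext_on _ _ c d)|..]; [apply H|..]; auto.
  - intros x y; unfold cont2.
    apply (continuous_comp_2 (fun z : R * R => clamp a b (fst z)) (fun z : R * R => clamp c d (snd z)) f).
    + apply (cont_comp (clamp a b) (fun z : R * R => fst z)); [cont | apply clamp_cont; auto].
    + apply (cont_comp (clamp c d) (fun z : R * R => snd z)); [cont | apply clamp_cont; auto].
    + apply C; apply clamp_in; auto.
  - intros y Hy; apply RInt_ext_on; auto; intros x Hx; rewrite !clamp_id; lra.
  - intros x Hx; apply RInt_ext_on; auto; intros y Hy; rewrite !clamp_id; lra.
Qed.

(** The sequence [I (A + n)] is Cauchy because [om] tends to 0, and letting [b'] tend to infinity in
    the hypothesis carries the rate over to the limit. Every integral over a half-line is obtained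
    this way, hence with an explicit tail bound. *)
Lemma cauchy_limit (I om : R -> R) A :
  (forall b b', A <= b <= b' -> Rabs (I b' - I b) <= om b) ->
  is_lim om p_infty 0 ->
  exists l, forall b, A <= b -> Rabs (l - I b) <= om b.
Proof.
  intros H Hom.
  assert (Hs : forall eps, 0 < eps -> exists B, A <= B /\ forall b, B <= b -> om b < eps).
  { intros eps He.
    apply is_lim_spec in Hom; destruct (Hom (mkposreal eps He)) as [B HB].
    exists (Rmax A (B + 1)); split; [apply Rmax_l|].
    intros b Hb; assert (Hc := Rmax_r A (B + 1)).
    assert (Hd := HB b ltac:(lra)); simpl in Hd.
    apply Rabs_lt_between in Hd; lra. }
  set (u := fun n => I (A + INR n)).
  assert (Cu : Cauchy_crit u).
  { intros eps He; destruct (Hs eps He) as [B [HA HB]].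
    destruct (nfloor_ex (B - A)) as [N HN]; [lra|].
    exists (S N).
    assert (K : forall n m, (n >= S N)%nat -> (n <= m)%nat -> Rabs (u m - u n) < eps).
    { intros n m Hn Hm; unfold u.
      apply le_INR in Hn, Hm; rewrite S_INR in Hn.
      apply Rle_lt_trans with (om (A + INR n)).
      - apply H; assert (Hi := pos_INR n); lra.
      - apply HB; lra. }
    intros n m Hn Hm; unfold Rdist.
    destruct (Nat.le_ge_cases n m); [rewrite Rabs_minus_sym|]; apply K; auto. }
  destruct (Rcomplete.R_complete u Cu) as [l Hl]; exists l; intros b Hb.
  apply le_epsilon; intros eps He.
  destruct (Hl eps He) as [N HN].
  destruct (nfloor_ex (b - A)) as [M HM]; [lra|].
  set (n := (S (max N M))).
  assert (Hn : Rabs (u n - l) < eps) by (apply (HN n); unfold n; lia).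
  assert (Hbn : b <= A + INR n).
  { assert (INR (S M) <= INR n) by (apply le_INR; unfold n; lia).
    rewrite S_INR in H0; lra. }
  assert (K := H b (A + INR n) ltac:(lra)); fold (u n) in K.
  replace (l - I b) with (- (u n - l) + (u n - I b)) by ring.
  eapply Rle_trans; [apply Rabs_triang|]; rewrite Rabs_Ropp; lra.
Qed.

Lemma exp_le x y : x <= y -> exp x <= exp y.
Proof. intros [H|H]; [left; apply exp_increasing; auto|rewrite H; lra]. Qed.

Lemma RInt_diff (f : R -> R) a b c : ex_RInt f a b -> ex_RInt f b c ->
  RInt f a c - RInt f a b = RInt f b c.
Proof. intros H1 H2; rewrite (RInt_split f a b c H1 H2); ring. Qed.

Lemma RInt_param_cont_clamp (f : R -> R -> R) a b c d x0 : a <= b -> c <= d ->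
  (forall x y, a <= x <= b -> c <= y <= d -> cont2 f x y) ->
  continuous (fun x => RInt (f (clamp a b x)) c d) x0.
Proof.
  intros L1 L2 C.
  apply continuous_ext with (fun x => RInt (fun y => f (clamp a b x) (clamp c d y)) c d).
  - intros x; apply RInt_ext_on; auto; intros y Hy; rewrite (clamp_id c d) by lra; reflexivity.
  - apply (RInt_param_cont (fun x y => f (clamp a b x) (clamp c d y))); auto.
    intros x y; unfold cont2.
    apply (continuous_comp_2 (fun z : R * R => clamp a b (fst z)) (fun z : R * R => clamp c d (snd z)) f).
    + apply (cont_comp (clamp a b) (fun z : R * R => fst z)); [cont | apply clamp_cont; auto].
    + apply (cont_comp (clamp c d) (fun z : R * R => snd z)); [cont | apply clamp_cont; auto].
    + apply C; apply clamp_in; auto.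
Qed.

(** * Improper integrals and integration by parts against a singular kernel *)

Lemma RInt_to_is_RInt (f : R -> R) a b v : ex_RInt f a b -> RInt f a b = v -> is_RInt f a b v.
Proof.
  intros E H; exists (ex_RInt_Reals_0 f a b E); rewrite <- RInt_Reals; exact H.
Qed.

Lemma is_RInt_to_RInt (f : R -> R) a b v : is_RInt f a b v -> RInt f a b = v.
Proof. intros [pr H]; rewrite (RInt_Reals f a b pr); exact H. Qed.

Lemma Cmod_re (z : Cplx) : snd z = 0 -> Cmod z = Rabs (fst z).
Proof.
  intros H; unfold Cmod; rewrite H, Rmult_0_r, Rplus_0_r; apply sqrt_Rsqr_abs.
Qed.

Lemma Cmod_le (z : Cplx) : Cmod z <= Rabs (fst z) + Rabs (snd z).
Proof.
  unfold Cmod; rewrite <- (sqrt_Rsqr (Rabs (fst z) + Rabs (snd z)))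
    by (generalize (Rabs_pos (fst z)) (Rabs_pos (snd z)); lra).
  apply sqrt_le_1_alt; unfold Rsqr.
  assert (H1 := Rabs_pos (fst z)); assert (H2 := Rabs_pos (snd z)).
  replace (fst z * fst z) with (Rabs (fst z) * Rabs (fst z)) by (rewrite <- Rabs_mult; apply Rabs_pos_eq; nra).
  replace (snd z * snd z) with (Rabs (snd z) * Rabs (snd z)) by (rewrite <- Rabs_mult; apply Rabs_pos_eq; nra).
  nra.
Qed.

Lemma Cmod_fst (z : Cplx) : Rabs (fst z) <= Cmod z.
Proof.
  unfold Cmod; rewrite <- sqrt_Rsqr_abs; apply sqrt_le_1_alt; unfold Rsqr; nra.
Qed.

Lemma Cmod_snd (z : Cplx) : Rabs (snd z) <= Cmod z.
Proof.
  unfold Cmod; rewrite <- sqrt_Rsqr_abs; apply sqrt_le_1_alt; unfold Rsqr; nra.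
Qed.

(** [F] has to be a primitive only inside the interval; at the ends its values are one-sided limits.
    This admits integrands that are singular at the ends. *)
Lemma improper_FTC (fc : R -> Cplx) (f F : R -> R) a b : a < b ->
  (forall x, a < x < b -> fc x = RtoC (f x)) ->
  (forall a' b', a < a' <= b' -> b' < b -> ex_RInt f a' b' /\ RInt f a' b' = F b' - F a') ->
  (forall eps, 0 < eps -> exists del, 0 < del /\
     forall x, a < x < b -> x < a + del -> Rabs (F x - F a) < eps) ->
  (forall eps, 0 < eps -> exists del, 0 < del /\
     forall x, a < x < b -> b - del < x -> Rabs (F x - F b) < eps) ->
  is_CInt_open fc a b (RtoC (F b - F a)).
Proof.
  intros Hab Hf HI Ha Hb eps He.
  destruct (Ha (eps / 2)) as [d1 [Hd1 H1]]; [lra|].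
  destruct (Hb (eps / 2)) as [d2 [Hd2 H2]]; [lra|].
  (* Half the length keeps [a' < b']. *)
  set (d := Rmin ((b - a) / 2) (Rmin d1 d2)).
  assert (L1 : d <= (b - a) / 2) by apply Rmin_l.
  assert (L2 : d <= Rmin d1 d2) by apply Rmin_r.
  assert (L3 : d <= d1) by (eapply Rle_trans; [apply L2|apply Rmin_l]).
  assert (L4 : d <= d2) by (eapply Rle_trans; [apply L2|apply Rmin_r]).
  exists d; split; [repeat apply Rmin_glb_lt; lra|].
  intros a' b' Ha' Hb'.
  destruct (HI a' b') as [E V]; [lra..|].
  exists (RtoC (F b' - F a')); split.
  - split; apply RInt_to_is_RInt.
    + apply ex_RInt_ext_on with f; [lra| |exact E]; intros x Hx; rewrite Hf by lra; reflexivity.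
    + simpl; rewrite <- V; symmetry; apply RInt_ext_on; [lra|].
      intros x Hx; rewrite Hf by lra; reflexivity.
    + apply ex_RInt_ext_on with (fun _ => 0); [lra| |apply (ex_RInt_const (V := R_NormedModule))].
      intros x Hx; rewrite Hf by lra; reflexivity.
    + rewrite (RInt_ext_on _ (fun _ => 0)); [rewrite RInt_Rconst; apply Rmult_0_r|lra|].
      intros x Hx; rewrite Hf by lra; reflexivity.
  - rewrite Cmod_re by (simpl; ring); simpl.
    assert (K1 := H1 a' ltac:(lra) ltac:(lra)).
    assert (K2 := H2 b' ltac:(lra) ltac:(lra)).
    apply Rabs_def2 in K1; apply Rabs_def2 in K2; apply Rabs_def1; lra.
Qed.

Lemma improper_FTC_cont (fc : R -> Cplx) (f F : R -> R) a b : a < b ->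
  (forall x, a < x < b -> fc x = RtoC (f x)) ->
  (forall x, a < x < b -> is_derive F x (f x)) ->
  (forall x, a < x < b -> continuous f x) ->
  continuous F a -> continuous F b ->
  is_CInt_open fc a b (RtoC (F b - F a)).
Proof.
  intros Hab Hf HD HC Ca Cb; apply improper_FTC with f; auto.
  - intros a' b' H1 H2; split.
    + apply ex_RInt_cont_on; [lra|]; intros; apply HC; lra.
    + apply RInt_FTC; [lra| |]; intros; [apply HD|apply HC]; lra.
  - intros eps He; destruct (proj1 (cont_eps _ _) Ca eps He) as [d [Hd H]].
    exists d; split; auto; intros x Hx Hx'; apply H, Rabs_def1; lra.
  - intros eps He; destruct (proj1 (cont_eps _ _) Cb eps He) as [d [Hd H]].
    exists d; split; auto; intros x Hx Hx'; apply H, Rabs_def1; lra.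
Qed.

Lemma increasing_deriv (f df : R -> R) a b : a <= b ->
  (forall x, a < x < b -> is_derive f x (df x)) ->
  (forall x, a <= x <= b -> continuous f x) ->
  (forall x, a < x < b -> 0 <= df x) -> f a <= f b.
Proof.
  intros L D C P.
  (* The mean value point may be an end point, where the sign of [df] is unknown; [Rmax 0] makes it
     nonnegative there too. *)
  destruct (MVT_gen f a b (fun x => Rmax 0 (df x))) as [c [Hc H]].
  - rewrite Rmin_left, Rmax_right by auto; intros x Hx.
    rewrite Rmax_right by (apply P; auto); apply D; auto.
  - rewrite Rmin_left, Rmax_right by auto; intros x Hx.
    apply continuity_pt_filterlim, C; auto.
  - assert (K := Rmax_l 0 (df c)); nra.
Qed.

(* With [E] as a distribution function, [int M (t - c) dE c = int K (t - c) * E c dc]: this is bounded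
   through bounds on [E], because [K >= 0]. *)
Section Stieltjes.
Context (M K : R -> R).
Context (Mcont : forall u, continuous M u).
Context (Mder : forall u, 0 < u -> is_derive M u (K u)).
Context (E E' : R -> R) (Eder : forall c, is_derive E c (E' c)).
Context (Econt : forall c, continuous E' c) (t : R).

(** The primitive of [K (t - s) * E s] found by parts. It involves [M] instead of [K], so it is
    continuous up to [s = t], where [K (t - s)] may blow up. *)
Let Z s := RInt (fun c => M (t - c) * E' c) 0 s - M (t - s) * E s.

Lemma Mconv_cont c : continuous (fun c => M (t - c) * E' c) c.
Proof. apply cont_mult; auto; apply (cont_comp M); auto; cont. Qed.

Lemma parts_cont s : continuous Z s.
Proof.
  unfold Z; apply cont_minus.
  - apply cont_RInt_upper, Mconv_cont.
  - apply cont_mult; [apply (cont_comp M); auto; cont|].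
    apply (cont_deriv _ _ _ (Eder s)).
Qed.

Lemma parts_deriv s : s < t -> is_derive Z s (K (t - s) * E s).
Proof.
  intros Hs; unfold Z.
  assert (D1 := is_derive_RInt_upper _ 0 s Mconv_cont).
  assert (D2 : is_derive (fun s => M (t - s)) s (- K (t - s))).
  { evar_last; [apply (is_derive_comp M (fun s => t - s))|].
    - apply Mder; lra.
    - auto_derive; [auto|reflexivity].
    - unfold scal; simpl; unfold mult; simpl; ring. }
  evar_last; [apply (is_derive_minus (V := R_NormedModule));
    [exact D1|apply (is_derive_mult (fun s => M (t - s)) E); [exact D2|apply Eder|]]|].
  - intros; apply Rmult_comm.
  - unfold minus, plus, opp, mult; simpl; ring.
Qed.

Context (M0 : M 0 = 0) (Kpos : forall u, 0 < u -> 0 <= K u) (E0 : E 0 = 0) (tpos : 0 <= t).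

Lemma comb_deriv b s : s < t ->
  is_derive (fun s => Z s + b * M (t - s)) s (K (t - s) * (E s - b)).
Proof.
  intros Hs.
  evar_last; [apply (is_derive_plus (V := R_NormedModule));
    [apply parts_deriv; auto|apply is_derive_scal, (is_derive_comp M (fun s => t - s))]|].
  - apply Mder; lra.
  - auto_derive; [auto|reflexivity].
  - unfold plus, scal; simpl; unfold mult; simpl; ring.
Qed.

Lemma comb_cont b s : continuous (fun s => Z s + b * M (t - s)) s.
Proof.
  apply cont_plus; [apply parts_cont|apply cont_mult; [cont|apply (cont_comp M); auto; cont]].
Qed.

(** [Z s + b * M (t - s)] has derivative [K (t - s) * (E s - b) <= 0]; compare its values at [0] and
    at [t]. *)
Lemma stieltjes_upper b : (forall c, 0 < c < t -> E c <= b) ->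
  RInt (fun c => M (t - c) * E' c) 0 t <= b * M t.
Proof.
  intros Hb.
  assert (H := increasing_deriv (fun s => - (Z s + b * M (t - s)))
     (fun s => - (K (t - s) * (E s - b))) 0 t tpos).
  assert (Z0 : Z 0 = 0) by (unfold Z; rewrite E0, RInt_Rpoint, Rmult_0_r; apply Rminus_0_r).
  assert (Zt : Z t = RInt (fun c => M (t - c) * E' c) 0 t)
    by (unfold Z; rewrite Rminus_diag, M0; ring).
  cbv beta in H; rewrite <- Zt; rewrite Z0, Rminus_diag, M0, Rminus_0_r in H.
  enough (- (0 + b * M t) <= - (Z t + b * 0)) by lra.
  apply H.
  - intros s Hs; apply (is_derive_opp (V := R_NormedModule)), comb_deriv; lra.
  - intros; apply cont_opp, comb_cont.
  - intros s Hs; assert (K1 := Kpos (t - s) ltac:(lra)); assert (K2 := Hb s Hs); nra.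
Qed.

(** Up to [h] only [E >= 0] is available, so [Z] increases; from [h] on [Z s + a * M (t - s)]
    increases. The loss of [[0, h]] shows as [M (t - h)] in place of [M t]. *)
Lemma stieltjes_lower a h : 0 <= h <= t -> (forall c, 0 < c < t -> 0 <= E c) ->
  (forall c, h < c < t -> a <= E c) ->
  a * M (t - h) <= RInt (fun c => M (t - c) * E' c) 0 t.
Proof.
  intros Hh HE Ha.
  assert (Z0 : Z 0 = 0) by (unfold Z; rewrite E0, RInt_Rpoint, Rmult_0_r; apply Rminus_0_r).
  assert (Zt : Z t = RInt (fun c => M (t - c) * E' c) 0 t)
    by (unfold Z; rewrite Rminus_diag, M0; ring).
  assert (H1 : Z 0 <= Z h).
  { apply increasing_deriv with (fun s => K (t - s) * E s); try lra.
    - intros; apply parts_deriv; lra.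
    - intros; apply parts_cont.
    - intros s Hs; apply Rmult_le_pos; [apply Kpos|apply HE]; lra. }
  assert (H2 : Z h + a * M (t - h) <= Z t + a * M (t - t)).
  { apply (increasing_deriv (fun s => Z s + a * M (t - s)) (fun s => K (t - s) * (E s - a))); try lra.
    - intros; apply comb_deriv; lra.
    - intros; apply comb_cont.
    - intros s Hs; apply Rmult_le_pos; [apply Kpos; lra|].
      assert (K2 := Ha s Hs); lra. }
  rewrite <- Zt; rewrite Rminus_diag, M0 in H2; lra.
Qed.

End Stieltjes.

(** * The flat function [exp (- 1 / (4 r))] and its derivatives *)

(** The powers of [r] make the family closed under differentiation up to linear combinations; the
    extension by 0 is smooth. *)
Definition flat (k : nat) (r : R) : R :=
  if Rlt_dec 0 r then exp (- / (4 * r)) / r ^ k else 0.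

Lemma flat_pos k r : 0 < r -> flat k r = exp (- / (4 * r)) / r ^ k.
Proof. intros H; unfold flat; destruct Rlt_dec; lra. Qed.

Lemma flat_neg k r : r <= 0 -> flat k r = 0.
Proof. intros H; unfold flat; destruct Rlt_dec; lra. Qed.

Lemma flat_ge0 k r : 0 <= flat k r.
Proof.
  unfold flat; destruct Rlt_dec; [|lra].
  left; apply Rdiv_lt_0_compat; [apply exp_pos|apply pow_lt; auto].
Qed.

Lemma pow_le_exp m z : 0 <= z -> z ^ m / INR (fact m) <= exp z.
Proof.
  intros Hz; eapply Rle_trans; [|apply (exp_ge_taylor z m Hz)].
  destruct m as [|m]; simpl; [lra|].
  assert (0 <= sum_f_R0 (fun k => z ^ k / INR (fact k)) m); [|simpl in *; lra].
  apply cond_pos_sum; intros k; apply Rdiv_le_0_compat; [apply pow_le; auto|apply INR_fact_lt_0].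
Qed.

(** Take the Taylor term of order [k + 2] of [exp] at [1 / (4 r)]. Second order in [r] serves both
    continuity at [0] and the vanishing of the derivative there. *)
Lemma flat_bound k : exists C, 0 < C /\ forall r, Rabs (flat k r) <= C * r ^ 2.
Proof.
  exists (INR (fact (k + 2)) * 4 ^ (k + 2)); split.
  { apply Rmult_lt_0_compat; [apply INR_fact_lt_0|apply pow_lt; lra]. }
  intros r; rewrite Rabs_pos_eq by apply flat_ge0.
  unfold flat; destruct Rlt_dec as [Hr|Hr].
  2: { apply Rmult_le_pos; [left; apply Rmult_lt_0_compat;
      [apply INR_fact_lt_0|apply pow_lt; lra]|apply pow2_ge_0]. }
  assert (Hp : 0 < r ^ k) by (apply pow_lt; auto).
  assert (Hi : 0 < / (4 * r)) by (apply Rinv_0_lt_compat; lra).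
  assert (H := pow_le_exp (k + 2) (/ (4 * r)) ltac:(lra)).
  rewrite exp_Ropp; set (z := / (4 * r)) in *.
  assert (Hf := INR_fact_lt_0 (k + 2)).
  assert (Hz : 0 < z ^ (k + 2)) by (apply pow_lt; auto).
  assert (He := exp_pos z).
  apply Rle_trans with (/ (z ^ (k + 2) / INR (fact (k + 2))) / r ^ k).
  - apply Rmult_le_compat_r; [left; apply Rinv_0_lt_compat; auto|].
    apply Rinv_le_contravar; auto; apply Rdiv_lt_0_compat; auto.
  - unfold z; rewrite pow_inv, Rpow_mult_distr, (Rdef_pow_add r); right.
    field; repeat split; try lra; try (apply pow_nonzero; lra).
Qed.

Lemma flat_cont k r : continuous (flat k) r.
Proof.
  destruct (Rtotal_order r 0) as [H|[H|H]].
  - apply continuous_ext_loc with (fun _ => 0); [|apply continuous_const].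
    apply (filter_imp (fun y => y < 0)); [|apply open_lt; auto].
    intros y Hy; symmetry; apply flat_neg; lra.
  - subst r; destruct (flat_bound k) as [C [HC HB]].
    apply cont_eps; intros eps He.
    assert (Hd : 0 < Rmin 1 (eps / C))
      by (apply Rmin_glb_lt; [lra|apply Rdiv_lt_0_compat; auto]).
    exists (Rmin 1 (eps / C)); split; auto; intros y Hy.
    rewrite (flat_neg k 0), Rminus_0_r by lra; rewrite Rminus_0_r in Hy.
    assert (K1 := Rmin_l 1 (eps / C)); assert (K2 := Rmin_r 1 (eps / C)).
    eapply Rle_lt_trans; [apply HB|].
    rewrite <- (pow2_abs y).
    apply Rle_lt_trans with (C * Rabs y).
    + assert (Hy0 := Rabs_pos y); assert (Hy1 : Rabs y <= 1) by lra.
      apply Rmult_le_compat_l; [lra|]; simpl; nra.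
    + apply (Rmult_lt_reg_r (/ C)); [apply Rinv_0_lt_compat; auto|].
      replace (C * Rabs y * / C) with (Rabs y) by (field; lra).
      unfold Rdiv in *; lra.
  - apply continuous_ext_loc with (fun r => exp (- / (4 * r)) / r ^ k).
    + apply (filter_imp (fun y => 0 < y)); [|apply open_gt; auto].
      intros y Hy; symmetry; apply flat_pos; auto.
    + apply cont_div; [apply pow_nonzero; lra| |]; cont; lra.
Qed.

Lemma flat_deriv k r :
  is_derive (flat k) r (flat (k + 2) r / 4 - INR k * flat (k + 1) r).
Proof.
  destruct (Rtotal_order r 0) as [H|[H|H]].
  - rewrite !flat_neg by lra.
    apply is_derive_ext_loc with (fun _ => 0).
    + apply (filter_imp (fun y => y < 0)); [|apply open_lt; auto].
      intros y Hy; symmetry; apply flat_neg; lra.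
    + auto_derive; auto; field.
  - subst r; rewrite !flat_neg by lra.
    destruct (flat_bound k) as [C [HC HB]].
    apply is_derive_Reals; intros eps He.
    assert (Hd : 0 < eps / C) by (apply Rdiv_lt_0_compat; auto).
    exists (mkposreal _ Hd); intros h Hh Hh'; simpl in Hh'.
    rewrite Rplus_0_l, (flat_neg k 0) by lra.
    replace ((flat k h - 0) / h - (0 / 4 - INR k * 0)) with (flat k h / h) by (field; auto).
    unfold Rdiv; rewrite Rabs_mult, Rabs_inv.
    assert (Hh0 := Rabs_pos_lt h Hh).
    apply (Rmult_lt_reg_r (Rabs h)); auto.
    rewrite Rmult_assoc, Rinv_l, Rmult_1_r by lra.
    eapply Rle_lt_trans; [apply HB|]; rewrite <- (pow2_abs h).
    simpl; rewrite Rmult_1_r, <- Rmult_assoc; apply Rmult_lt_compat_r; auto.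
    apply (Rmult_lt_reg_r (/ C)); [apply Rinv_0_lt_compat; auto|].
    replace (C * Rabs h * / C) with (Rabs h) by (field; lra); auto.
  - apply is_derive_ext_loc with (fun r => exp (- / (4 * r)) / r ^ k).
    + apply (filter_imp (fun y => 0 < y)); [|apply open_gt; auto].
      intros y Hy; symmetry; apply flat_pos; auto.
    + rewrite !flat_pos, !Rdef_pow_add by auto.
      assert (r ^ k <> 0) by (apply pow_nonzero; lra).
      auto_derive; [split; auto; lra|].
      destruct k as [|k]; simpl pred.
      * simpl; field; lra.
      * rewrite S_INR; simpl pow in *.
        assert (r ^ k <> 0) by (apply pow_nonzero; lra).
        field; lra.
Qed.

(** The [e] of the overview: [NEp 1], extended by 0 to [r <= 0]. *)
Definition prof r := flat 1 r / 2.
Definition prof' r := flat 3 r / 8 - flat 2 r / 2.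

Lemma prof_deriv r : is_derive prof r (prof' r).
Proof.
  unfold prof.
  apply is_derive_ext with (fun r => / 2 * flat 1 r); [intros; unfold Rdiv; apply Rmult_comm|].
  evar_last; [apply is_derive_scal, flat_deriv|].
  unfold prof'; simpl; field.
Qed.

Lemma prof_cont r : continuous prof r.
Proof. apply (cont_deriv _ _ _ (prof_deriv r)). Qed.

Lemma prof'_cont r : continuous prof' r.
Proof. unfold prof'; cont; try lra; apply flat_cont. Qed.

Lemma prof_neg r : r <= 0 -> prof r = 0.
Proof. intros H; unfold prof; rewrite flat_neg; lra. Qed.

Lemma prof'_neg r : r <= 0 -> prof' r = 0.
Proof. intros H; unfold prof'; rewrite !flat_neg; lra. Qed.

(* The self-convolution of [prof] is [p * flat_mean' p] ([prof_conv_eq]), so that [flat_mean (c / x ^ 2)]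
   is, up to a factor, a primitive in [x] of the self-convolution of the Neumann kernel. *)
Definition flat_mean p := RInt (fun z => flat 0 (p * (z * (1 - z)))) 0 1.
Definition flat_mean' p := RInt (fun z => z * (1 - z) * (flat 2 (p * (z * (1 - z))) / 4)) 0 1.

Lemma flat_mean_int p z : continuous (fun z => flat 0 (p * (z * (1 - z)))) z.
Proof. apply (cont_comp (flat 0)); [cont|apply flat_cont]. Qed.

Lemma flat_mean'_int p z : cont2 (fun p z => z * (1 - z) * (flat 2 (p * (z * (1 - z))) / 4)) p z.
Proof. unfold cont2; cont; try lra. apply (cont_comp (flat 2)); [cont|apply flat_cont]. Qed.

Lemma flat_mean_deriv p : is_derive flat_mean p (flat_mean' p).
Proof.
  apply (RInt_param_deriv (fun p z => flat 0 (p * (z * (1 - z))))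
    (fun p z => z * (1 - z) * (flat 2 (p * (z * (1 - z))) / 4))); [lra| | |].
  - intros x z; evar_last.
    + apply (is_derive_comp (flat 0) (fun p => p * (z * (1 - z)))); [apply flat_deriv|].
      auto_derive; [auto|reflexivity].
    + unfold scal; simpl; unfold mult; simpl; field.
  - apply flat_mean'_int.
  - intros; apply ex_RInt_cont, flat_mean_int.
Qed.

Lemma flat_mean'_cont p : continuous flat_mean' p.
Proof. apply (RInt_param_cont _ 0 1 p); [lra|apply flat_mean'_int]. Qed.

Lemma flat_mean_0 : flat_mean 0 = 0.
Proof.
  unfold flat_mean; rewrite (RInt_ext _ (fun _ => 0)); [rewrite RInt_Rconst; apply Rmult_0_r|].
  intros; apply flat_neg; lra.
Qed.

Lemma flat_mean_ge0 p : 0 <= flat_mean p.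
Proof. apply RInt_nonneg; [lra|apply ex_RInt_cont, flat_mean_int|intros; apply flat_ge0]. Qed.

Lemma flat0_le r r' : r <= r' -> flat 0 r <= flat 0 r'.
Proof.
  intros H; destruct (Rle_or_lt r 0) as [Hr|Hr].
  - rewrite flat_neg by auto; apply flat_ge0.
  - rewrite !flat_pos by lra; rewrite !pow_O, !Rdiv_1_r.
    apply exp_le, Ropp_le_contravar, Rinv_le_contravar; lra.
Qed.

(** Since [z * (1 - z) <= 1 / 4], the exponent [- 1 / (4 p z (1 - z))] is at most [- 1 / p]. This is
    the origin of the error [exp (- 1 / t)]. *)
Lemma flat_mean_le p : 0 < p -> flat_mean p <= exp (- / p).
Proof.
  intros Hp; apply Rle_trans with (RInt (fun _ => exp (- / p)) 0 1); [|rewrite RInt_Rconst; lra].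
  apply RInt_le; [lra|apply ex_RInt_cont, flat_mean_int|apply (ex_RInt_const (V := R_NormedModule))|].
  intros z Hz; apply Rle_trans with (flat 0 (p / 4)).
  - apply flat0_le; assert (0 <= (z - / 2) * (z - / 2)) by apply Rle_0_sqr; nra.
  - rewrite flat_pos by lra; rewrite pow_O, Rdiv_1_r; right; do 2 f_equal; field; lra.
Qed.

Lemma flat_mean_le1 p : flat_mean p <= 1.
Proof.
  apply Rle_trans with (RInt (fun _ => 1) 0 1); [|rewrite RInt_Rconst; lra].
  apply RInt_le; [lra|apply ex_RInt_cont, flat_mean_int|apply (ex_RInt_const (V := R_NormedModule))|].
  intros z Hz; unfold flat; destruct Rlt_dec as [H|H]; [|lra].
  rewrite pow_O, Rdiv_1_r; apply Rle_trans with (exp 0); [apply exp_le|rewrite exp_0; lra].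
    assert (0 < / (4 * (p * (z * (1 - z))))) by (apply Rinv_0_lt_compat; lra); lra.
Qed.

Lemma flat_mean_lim d : 0 < d < 1 -> exists P, 0 < P /\ forall p, P <= p -> 1 - d <= flat_mean p.
Proof.
  (* Only [[h, 1 - h]] is kept, and [P] makes the integrand at least [1 - d / 2] there; the product
     [(1 - 2 h) (1 - d / 2)] is [(1 - d / 2) ^ 2 >= 1 - d]. *)
  intros Hd; set (h := d / 4); exists (2 / (h * d)).
  assert (Hh : 0 < h * d) by (unfold h; nra).
  split; [apply Rdiv_lt_0_compat; lra|]; intros p Hp.
  assert (Hp0 : 2 <= p * (h * d)).
  { apply (Rmult_le_compat_r (h * d)) in Hp; [|lra].
    unfold Rdiv in Hp; rewrite Rmult_assoc, Rinv_l in Hp; lra. }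
  assert (Hpp : 0 < p) by nra.
  assert (Hh1 : 0 < h < 1 / 4) by (unfold h; lra).
  unfold flat_mean.
  rewrite (RInt_split _ 0 h 1), (RInt_split _ h (1 - h) 1) by (apply ex_RInt_cont, flat_mean_int).
  assert (I1 : 0 <= RInt (fun z => flat 0 (p * (z * (1 - z)))) 0 h)
    by (apply RInt_nonneg; [lra|apply ex_RInt_cont, flat_mean_int|intros; apply flat_ge0]).
  assert (I3 : 0 <= RInt (fun z => flat 0 (p * (z * (1 - z)))) (1 - h) 1)
    by (apply RInt_nonneg; [lra|apply ex_RInt_cont, flat_mean_int|intros; apply flat_ge0]).
  assert (I2 : (1 - h - h) * (1 - d / 2) <= RInt (fun z => flat 0 (p * (z * (1 - z)))) h (1 - h)).
  { rewrite <- RInt_Rconst.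
    apply RInt_le; [lra|apply (ex_RInt_const (V := R_NormedModule))|apply ex_RInt_cont, flat_mean_int|].
    intros z Hz; assert (Hw : h / 2 <= z * (1 - z)) by nra.
    rewrite flat_pos by nra; rewrite pow_O, Rdiv_1_r.
    eapply Rle_trans; [|apply exp_ineq1_le].
    enough (/ (4 * (p * (z * (1 - z)))) <= d / 2) by lra.
    assert (Hq : 1 / d <= p * (z * (1 - z))).
    { apply (Rmult_le_reg_r d); [lra|]; unfold Rdiv; rewrite Rmult_assoc, Rinv_l by lra. nra. }
    apply Rle_trans with (/ (4 * (1 / d))).
    - assert (0 < 1 / d) by (apply Rdiv_lt_0_compat; lra).
      apply Rinv_le_contravar; lra.
    - replace (/ (4 * (1 / d))) with (d / 4) by (field; lra); lra. }
  unfold h in *; nra.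
Qed.

(** * The self-convolution of [prof] *)

Definition prof_conv p := RInt (fun v => prof v * prof (p - v)) 0 p.
Definition prof_conv' p := RInt (fun v => prof v * prof' (p - v)) 0 p.

(** With an upper bound that does not depend on [p], differentiation under the integral sign
    produces no boundary term. *)
Lemma prof_conv_upper (g : R -> R) p P : (forall r, continuous g r) -> (forall r, r <= 0 -> g r = 0) ->
  p <= P -> 0 <= P ->
  RInt (fun v => prof v * g (p - v)) 0 p = RInt (fun v => prof v * g (p - v)) 0 P.
Proof.
  intros Cg Hg H1 H2.
  assert (C : forall v, continuous (fun v => prof v * g (p - v)) v).
  { intros; apply cont_mult; [apply prof_cont|apply (cont_comp g); [cont|apply Cg]]. }
  rewrite (RInt_split _ 0 p P) by (apply ex_RInt_cont, C).
  rewrite (RInt_ext_on _ (fun _ => 0) p P); [rewrite RInt_Rconst, Rmult_0_r; symmetry; apply Rplus_0_r|auto|].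
  intros v Hv; rewrite (Hg (p - v)) by lra; apply Rmult_0_r.
Qed.

Lemma prof_conv_deriv p : is_derive prof_conv p (prof_conv' p).
Proof.
  set (P := Rabs p + 1).
  assert (HP : p < P /\ 0 <= P) by (unfold P, Rabs; destruct Rcase_abs; lra).
  apply is_derive_ext_loc with (fun p => RInt (fun v => prof v * prof (p - v)) 0 P).
  - apply (filter_imp (fun y => y < P)); [|apply open_lt; lra].
    intros y Hy; symmetry; apply (prof_conv_upper prof y P); [apply prof_cont|apply prof_neg|lra|lra].
  - unfold prof_conv'; rewrite (prof_conv_upper prof' p P) by (apply prof'_cont || apply prof'_neg || lra).
    apply (RInt_param_deriv (fun p v => prof v * prof (p - v)) (fun p v => prof v * prof' (p - v))); [lra| | |].
    + intros x y; apply is_derive_scal.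
      evar_last; [apply (is_derive_comp prof (fun x => x - y)); [apply prof_deriv|]|].
      * auto_derive; [auto|reflexivity].
      * unfold scal; simpl; unfold mult; simpl; ring.
    + intros x y; unfold cont2; apply cont_mult.
      * apply (cont_comp prof); [cont|apply prof_cont].
      * apply (cont_comp prof'); [cont|apply prof'_cont].
    + intros x; apply ex_RInt_cont; intros v; apply cont_mult; [apply prof_cont|].
      apply (cont_comp prof); [cont|apply prof_cont].
Qed.

Lemma prof_conv'_cont p : continuous prof_conv' p.
Proof.
  set (P := Rabs p + 1).
  assert (HP : p < P /\ 0 <= P) by (unfold P, Rabs; destruct Rcase_abs; lra).
  apply continuous_ext_loc with (fun p => RInt (fun v => prof v * prof' (p - v)) 0 P).
  - apply (filter_imp (fun y => y < P)); [|apply open_lt; lra].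
    intros y Hy; symmetry; apply (prof_conv_upper prof' y P); [apply prof'_cont|apply prof'_neg|lra|lra].
  - apply (RInt_param_cont (fun p v => prof v * prof' (p - v))); [lra|].
    intros x y; unfold cont2; apply cont_mult.
    + apply (cont_comp prof); [cont|apply prof_cont].
    + apply (cont_comp prof'); [cont|apply prof'_cont].
Qed.

(** Substitute [v = p z]: the exponents [- 1 / (4 p z)] and [- 1 / (4 p (1 - z))] add up to
    [- 1 / (4 p z (1 - z))]. *)
Lemma prof_conv_eq p : 0 < p -> prof_conv p = p * flat_mean' p.
Proof.
  intros Hp; unfold prof_conv, flat_mean'.
  assert (C : forall v, continuous (fun v => prof v * prof (p - v)) v).
  { intros; apply cont_mult; [apply prof_cont|apply (cont_comp prof); [cont|apply prof_cont]]. }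
  assert (H := RInt_affine (fun v => prof v * prof (p - v)) p 0 0 1 C).
  replace (p * 0 + 0) with 0 in H by ring; replace (p * 1 + 0) with p in H by ring.
  rewrite <- H; clear H.
  rewrite <- RInt_Rscal by (apply ex_RInt_cont; intros; apply (cont2_right (fun p z => z * (1 - z) * (flat 2 (p * (z * (1 - z))) / 4))), flat_mean'_int).
  apply RInt_ext_on; [lra|]; intros z Hz.
  assert (H1 : 0 < p * z) by nra. assert (H2 : 0 < p * (1 - z)) by nra.
  replace (p - (p * z + 0)) with (p * (1 - z)) by ring; rewrite Rplus_0_r.
  unfold prof; rewrite !flat_pos by (auto; replace (p * (z * (1 - z))) with (p * z * (1 - z)) by ring; nra).
  replace (- / (4 * (p * (z * (1 - z))))) with (- / (4 * (p * z)) + - / (4 * (p * (1 - z))))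
    by (field; lra).
  rewrite exp_plus; field; lra.
Qed.

(** * The kernel K as a Laplace transform *)

(** Twice [log (sqrt y) + kap]; on the ray of argument [phi] the denominator becomes
    [ln_shift + i phi]. *)
Definition ln_shift (kap y : R) := ln y + 2 * kap.

Lemma log_vanishing_cont kap (g : R -> R) :
  (forall y, y <= 0 -> g y = 0) ->
  (forall y, 0 < y -> continuous g y) ->
  (forall y, 0 < y -> ln_shift kap y < 0 -> Rabs (g y) <= / (- ln_shift kap y)) ->
  forall y, continuous g y.
Proof.
  intros H0 Hc Hb y; destruct (Rtotal_order y 0) as [H|[H|H]]; [| |auto].
  - apply continuous_ext_loc with (fun _ => 0); [|apply continuous_const].
    apply (filter_imp (fun y => y < 0)); [|apply open_lt; auto].
    intros z Hz; symmetry; apply H0; lra.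
  - subst y; apply cont_eps; intros eps He.
    (* Below this radius [ln_shift kap y < - 1 / eps]. *)
    exists (exp (- / eps - 2 * kap)); split; [apply exp_pos|].
    intros y Hy; rewrite (H0 0), Rminus_0_r by lra; rewrite Rminus_0_r in Hy.
    destruct (Rle_or_lt y 0) as [Hn|Hp]; [rewrite H0, Rabs_R0; auto|].
    rewrite Rabs_pos_eq in Hy by lra.
    assert (Hl : ln_shift kap y < - / eps).
    { unfold ln_shift; apply ln_increasing in Hy; auto; rewrite ln_exp in Hy; lra. }
    assert (Hi : 0 < / eps) by (apply Rinv_0_lt_compat; auto).
    eapply Rle_lt_trans; [apply Hb; lra|].
    rewrite <- (Rinv_inv eps); apply Rinv_lt_contravar; [apply Rmult_lt_0_compat; lra|lra].
Qed.

Lemma PI_gt3 : 3 < PI.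
Proof. assert (H := PI2_3_2); unfold PI2 in H; lra. Qed.

(* Extended by [0] to [y <= 0], where Rocq's [ln] is [0]; this makes [weight] continuous at [0]. *)
Definition weight (kap y : R) := if Rlt_dec 0 y then / (ln_shift kap y ^ 2 + PI ^ 2) else 0.

Lemma weight_pos kap y : 0 < y -> weight kap y = / (ln_shift kap y ^ 2 + PI ^ 2).
Proof. intros H; unfold weight; destruct Rlt_dec; lra. Qed.

Lemma den_ge9 x : 9 <= x ^ 2 + PI ^ 2.
Proof. assert (H := PI_gt3); assert (0 <= x ^ 2) by apply pow2_ge_0; nra. Qed.

Lemma weight_ge0 kap y : 0 <= weight kap y.
Proof.
  unfold weight; destruct Rlt_dec; [|lra].
  left; apply Rinv_0_lt_compat; assert (H := den_ge9 (ln_shift kap y)); lra.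
Qed.

Lemma weight_le1 kap y : weight kap y <= 1.
Proof.
  unfold weight; destruct Rlt_dec; [|lra].
  assert (H := den_ge9 (ln_shift kap y)).
  rewrite <- Rinv_1; apply Rinv_le_contravar; lra.
Qed.

Lemma ln_shift_cont kap y : 0 < y -> continuous (ln_shift kap) y.
Proof. intros H; unfold ln_shift; cont. Qed.

Lemma weight_cont kap y : continuous (weight kap) y.
Proof.
  apply (log_vanishing_cont kap).
  - intros z Hz; unfold weight; destruct Rlt_dec; lra.
  - intros z Hz; apply continuous_ext_loc with (fun y => / (ln_shift kap y ^ 2 + PI ^ 2)).
    + apply (filter_imp (fun y => 0 < y)); [|apply open_gt; auto].
      intros t Ht; symmetry; apply weight_pos; auto.
    + assert (H := den_ge9 (ln_shift kap z)).
      apply cont_inv; [lra|]; apply cont_plus; [|cont].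
      apply cont_pow, ln_shift_cont; auto.
  - intros z Hz Hl; rewrite Rabs_pos_eq by apply weight_ge0; rewrite weight_pos by auto.
    assert (H := PI_gt3); apply Rinv_le_contravar; [lra|].
    assert (0 <= (ln_shift kap z + 1) ^ 2) by apply pow2_ge_0; nra.
Qed.

(** In the variable [L = ln_shift kap y] the measure [weight y / y dy] is [dL / (L ^ 2 + PI ^ 2)],
    of finite total mass. *)
Definition weight_prim (kap y : R) := atan (ln_shift kap y / PI) / PI.

Lemma weight_prim_deriv kap y : 0 < y -> is_derive (weight_prim kap) y (weight kap y / y).
Proof.
  intros Hy; rewrite weight_pos by auto; unfold weight_prim, ln_shift; assert (H := PI_RGT_0).
  assert (H9 := den_ge9 (ln_shift kap y)); unfold ln_shift in H9.
  auto_derive; [auto|].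
  unfold Rsqr; field; repeat split; nra.
Qed.

Lemma weight_prim_lt kap y : weight_prim kap y < / 2.
Proof.
  unfold weight_prim; assert (H := PI_RGT_0); assert (Ha := atan_bound (ln_shift kap y / PI)).
  apply (Rmult_lt_reg_r PI); auto; unfold Rdiv at 1; rewrite Rmult_assoc, Rinv_l by lra; lra.
Qed.

Lemma lim_ln_shift kap : is_lim (ln_shift kap) p_infty p_infty.
Proof.
  unfold ln_shift; apply is_lim_plus with p_infty (2 * kap); [apply is_lim_ln_p|apply is_lim_const|reflexivity].
Qed.

(** The quantity is the tail [2 int_R^oo weight y / y dy]. *)
Lemma lim_weight_prim kap : is_lim (fun R => 1 - 2 * weight_prim kap R) p_infty 0.
Proof.
  assert (Hp := PI_RGT_0).
  apply is_lim_spec; intros eps; simpl.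
  assert (He := cond_pos eps).
  set (a := PI / 2 - Rmin (PI / 4) (eps * PI / 4)).
  assert (Ha : PI / 4 <= a < PI / 2).
  { unfold a; assert (0 < Rmin (PI / 4) (eps * PI / 4)) by (apply Rmin_glb_lt; nra).
    assert (Hm := Rmin_l (PI / 4) (eps * PI / 4)); lra. }
  assert (Ha' : PI / 2 - eps * PI / 4 <= a)
    by (unfold a; assert (Hm := Rmin_r (PI / 4) (eps * PI / 4)); lra).
  assert (Hl := lim_ln_shift kap); apply is_lim_spec in Hl.
  destruct (Hl (tan a * PI)) as [A HA]; exists A; intros x Hx.
  assert (H := HA x Hx).
  assert (Hat : a < atan (ln_shift kap x / PI)).
  { rewrite <- (atan_tan a) by lra; apply atan_increasing.
    apply (Rmult_lt_reg_r PI); auto; unfold Rdiv; rewrite Rmult_assoc, Rinv_l; lra. }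
  rewrite Rminus_0_r; assert (H2 := weight_prim_lt kap x); rewrite Rabs_pos_eq by lra.
  unfold weight_prim; apply (Rmult_lt_reg_r PI); auto.
  replace ((1 - 2 * (atan (ln_shift kap x / PI) / PI)) * PI) with (PI - 2 * atan (ln_shift kap x / PI)) by (field; lra).
  nra.
Qed.

(** * Truncated Laplace integrals and their limits *)

Definition K_ker (kap u y : R) := 2 * (exp (- (u * y)) * weight kap y).
Definition K_trunc (kap R u : R) := RInt (K_ker kap u) 0 R.
Definition M_trunc (kap R u : R) := RInt (K_trunc kap R) 0 u.
Definition M_ker (kap u y : R) := RInt (fun v => K_ker kap v y) 0 u.

Lemma K_ker_cont2 kap u y : cont2 (K_ker kap) u y.
Proof.
  unfold cont2, K_ker; cont. apply (cont_comp (weight kap)); [cont|apply weight_cont].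
Qed.

Lemma K_ker_ge0 kap u y : 0 <= K_ker kap u y.
Proof.
  unfold K_ker; assert (H1 := exp_pos (- (u * y))); assert (H2 := weight_ge0 kap y); nra.
Qed.

Lemma K_ker_int kap u a b : ex_RInt (K_ker kap u) a b.
Proof. apply ex_RInt_cont; intros; apply cont2_right, K_ker_cont2. Qed.

Lemma K_trunc_cont kap R u : 0 <= R -> continuous (K_trunc kap R) u.
Proof. intros H; apply (RInt_param_cont (K_ker kap)); auto; apply K_ker_cont2. Qed.

Lemma M_ker_int kap u a b : 0 <= u -> ex_RInt (M_ker kap u) a b.
Proof.
  intros Hu; apply ex_RInt_cont; intros y.
  apply (RInt_param_cont (fun y v => K_ker kap v y)); auto.
  intros; apply cont2_swap, K_ker_cont2.
Qed.

Lemma M_trunc_eq kap R u : 0 <= R -> 0 <= u -> M_trunc kap R u = RInt (M_ker kap u) 0 R.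
Proof.
  intros HR Hu; unfold M_trunc, K_trunc, M_ker; apply (Fubini (K_ker kap)); auto.
  intros; apply K_ker_cont2.
Qed.

Lemma M_ker_eq kap u y : 0 < y -> 0 <= u ->
  M_ker kap u y = 2 * (1 - exp (- (u * y))) * (weight kap y / y).
Proof.
  intros Hy Hu; unfold M_ker.
  rewrite (RInt_FTC (fun v => - 2 * exp (- (v * y)) * (weight kap y / y))); auto.
  - rewrite Rmult_0_l, Ropp_0, exp_0; lra.
  - intros v _; unfold K_ker; auto_derive; [auto|field; lra].
  - intros v _; apply (cont2_left (K_ker kap)), K_ker_cont2.
Qed.

(** [Lim] is total, so limits can be defined before they are known to exist; the rate shows that its
    value is the true limit and not a default. *)
Lemma Lim_rate (I om : R -> R) A :
  (forall b b', A <= b <= b' -> Rabs (I b' - I b) <= om b) ->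
  is_lim om p_infty 0 ->
  forall b, A <= b -> Rabs (real (Lim I p_infty) - I b) <= om b.
Proof.
  intros H Hom; destruct (cauchy_limit I om A H Hom) as [l Hl].
  replace (real (Lim I p_infty)) with l; auto.
  symmetry; assert (E : Lim I p_infty = l); [|rewrite E; reflexivity].
  apply is_lim_unique, is_lim_spec; intros eps; simpl.
  apply is_lim_spec in Hom; destruct (Hom eps) as [B HB].
  exists (Rmax A B); intros x Hx.
  assert (H1 := Rmax_l A B); assert (H2 := Rmax_r A B).
  assert (H3 := HB x ltac:(lra)); rewrite Rminus_0_r in H3.
  rewrite Rabs_minus_sym; eapply Rle_lt_trans; [apply Hl; lra|].
  eapply Rle_lt_trans; [apply Rle_abs|apply H3].
Qed.

Lemma lim_exp_decay a c : 0 < a -> is_lim (fun R => c * exp (- (a * R))) p_infty 0.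
Proof.
  intros Ha; replace (Finite 0) with (Rbar_mult c 0) by (simpl; f_equal; ring).
  apply is_lim_scal_l, is_lim_comp with m_infty; [apply is_lim_exp_m| |].
  - apply is_lim_opp with (l := p_infty).
    replace p_infty with (Rbar_mult a p_infty) at 2.
    + apply is_lim_scal_l, is_lim_id.
    + simpl; destruct Rle_dec; [|lra]; destruct Rle_lt_or_eq_dec; auto; lra.
  - exists 0; discriminate.
Qed.

(* [K_real] is only meaningful for [0 < u]; [Rmax 0] makes [M_real] continuous on the whole line. *)
Definition K_real (kap u : R) := real (Lim (fun R => K_trunc kap R u) p_infty).
Definition M_real (kap u : R) := real (Lim (fun R => M_trunc kap R (Rmax 0 u)) p_infty).

(** From [weight <= 1]. The rate degenerates as [u -> 0], hence statements about [K_real] need [u]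
    bounded away from 0. *)
Lemma K_real_rate kap u R : 0 < u -> 0 <= R -> Rabs (K_real kap u - K_trunc kap R u) <= 2 / u * exp (- (u * R)).
Proof.
  intros Hu; revert R; apply (Lim_rate (fun R => K_trunc kap R u)); [|apply lim_exp_decay; auto].
  intros R R' HR; unfold K_trunc.
  rewrite (RInt_diff _ 0 R R') by apply K_ker_int.
  apply Rle_trans with (RInt (fun y => 2 * exp (- (u * y))) R R').
  - apply RInt_abs_le; [lra|apply K_ker_int|apply ex_RInt_cont; intros; cont|].
    intros y _; rewrite Rabs_pos_eq by apply K_ker_ge0; unfold K_ker.
    assert (H1 := exp_pos (- (u * y))); assert (H2 := weight_le1 kap y); nra.
  - rewrite (RInt_FTC (fun y => - (2 / u) * exp (- (u * y)))); [|lra| |intros; cont].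
    + assert (H1 := exp_pos (- (u * R'))); assert (0 < 2 / u) by (apply Rdiv_lt_0_compat; lra); nra.
    + intros; auto_derive; [auto|field; lra].
Qed.

(** From [1 - exp (- (u * y)) <= 1], hence uniformly in [u]: [M_real] is a uniform limit of
    continuous functions, also at [u = 0]. *)
Lemma M_real_rate kap u R : 0 <= u -> 1 <= R -> Rabs (M_real kap u - M_trunc kap R u) <= 1 - 2 * weight_prim kap R.
Proof.
  intros Hu; rewrite <- (Rmax_right 0 u) at 2 by auto; revert R.
  apply (Lim_rate (fun R => M_trunc kap R (Rmax 0 u))); [|apply lim_weight_prim].
  rewrite Rmax_right by auto; intros R R' HR.
  rewrite !M_trunc_eq by lra.
  rewrite (RInt_diff _ 0 R R') by (apply M_ker_int; auto).
  assert (C : forall x, R <= x <= R' -> continuous (fun y => 2 * (weight kap y / y)) x).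
  { intros; cont; [lra|apply weight_cont]. }
  apply Rle_trans with (RInt (fun y => 2 * (weight kap y / y)) R R').
  - apply RInt_abs_le; [lra|apply M_ker_int; auto|apply ex_RInt_cont_on; [lra|auto]|].
    intros y Hy; rewrite M_ker_eq by lra.
    assert (0 <= weight kap y / y) by (apply Rdiv_le_0_compat; [apply weight_ge0|lra]).
    assert (H1 := exp_pos (- (u * y))).
    assert (exp (- (u * y)) <= 1) by (rewrite <- exp_0; apply exp_le; nra).
    rewrite Rabs_pos_eq by (apply Rmult_le_pos; lra). nra.
  - rewrite (RInt_FTC (fun y => 2 * weight_prim kap y)); [|lra| |auto].
    + assert (H := weight_prim_lt kap R'); lra.
    + intros y Hy; apply is_derive_scal, weight_prim_deriv; lra.
Qed.

Lemma K_real_ge0 kap u : 0 < u -> 0 <= K_real kap u.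
Proof.
  intros Hu; apply le_epsilon; intros eps He.
  assert (H := lim_exp_decay u (2 / u) Hu); apply is_lim_spec in H.
  destruct (H (mkposreal eps He)) as [A HA]; simpl in HA.
  set (R := Rmax 0 (A + 1)).
  assert (H1 := Rmax_l 0 (A + 1)); assert (H2 := Rmax_r 0 (A + 1)); fold R in H1, H2.
  assert (H3 := HA R ltac:(lra)); rewrite Rminus_0_r in H3.
  assert (H4 := K_real_rate kap u R Hu H1).
  assert (H5 : 0 <= K_trunc kap R u) by (apply RInt_nonneg; auto using K_ker_int; intros; apply K_ker_ge0).
  apply Rabs_def2 in H3; apply Rabs_le_between in H4; lra.
Qed.

Lemma K_real_cont kap u : 0 < u -> continuous (K_real kap) u.
Proof.
  intros Hu; apply cont_eps; intros eps He.
  (* This is the rate of [K_real_rate] at [u / 2]; it dominates the rate at every [v > u / 2]. *)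
  assert (H := lim_exp_decay (u / 2) (4 / u) ltac:(lra)); apply is_lim_spec in H.
  assert (He3 : 0 < eps / 3) by lra.
  destruct (H (mkposreal (eps / 3) He3)) as [A HA]; simpl in HA.
  set (R := Rmax 0 (A + 1)).
  assert (H1 := Rmax_l 0 (A + 1)); assert (H2 := Rmax_r 0 (A + 1)); fold R in H1, H2.
  assert (H3 := HA R ltac:(lra)); rewrite Rminus_0_r in H3; apply Rabs_def2 in H3.
  assert (Hr : forall v, u / 2 < v -> Rabs (K_real kap v - K_trunc kap R v) < eps / 3).
  { intros v Hv; eapply Rle_lt_trans; [apply K_real_rate; lra|].
    eapply Rle_lt_trans; [|apply H3].
    apply Rmult_le_compat; [left; apply Rdiv_lt_0_compat; lra|left; apply exp_pos| |].
    - replace (4 / u) with (2 / (u / 2)) by (field; lra).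
      apply Rmult_le_compat_l; [lra|apply Rinv_le_contravar; lra].
    - apply exp_le; nra. }
  destruct (proj1 (cont_eps _ _) (K_trunc_cont kap R u H1) (eps / 3) He3) as [d [Hd HC]].
  exists (Rmin d (u / 2)); split; [apply Rmin_glb_lt; lra|].
  intros v Hv.
  assert (L1 := Rmin_l d (u / 2)); assert (L2 := Rmin_r d (u / 2)).
  assert (Hv' := HC v ltac:(lra)).
  apply Rabs_def2 in Hv.
  assert (K1 := Hr v ltac:(lra)); assert (K2 := Hr u ltac:(lra)).
  apply Rabs_def2 in Hv'; apply Rabs_def2 in K1; apply Rabs_def2 in K2.
  apply Rabs_def1; lra.
Qed.

Lemma weight_prim_near_half kap eps : 0 < eps -> exists R, 1 <= R /\ forall R', R <= R' -> 1 - 2 * weight_prim kap R' < eps.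
Proof.
  intros He; assert (H := lim_weight_prim kap); apply is_lim_spec in H.
  destruct (H (mkposreal eps He)) as [A HA]; simpl in HA.
  exists (Rmax 1 (A + 1)); split; [apply Rmax_l|]; intros R' HR.
  assert (H2 := Rmax_r 1 (A + 1)).
  assert (H3 := HA R' ltac:(lra)); rewrite Rminus_0_r in H3; apply Rabs_def2 in H3; lra.
Qed.

Lemma Rmax0_cont u : continuous (Rmax 0) u.
Proof.
  apply cont_eps; intros eps He; exists eps; split; auto; intros y.
  unfold Rmax, Rabs; repeat destruct Rle_dec; repeat destruct Rcase_abs; lra.
Qed.

Lemma M_real_max kap u : M_real kap u = M_real kap (Rmax 0 u).
Proof. unfold M_real; rewrite (Rmax_right 0 (Rmax 0 u)) by apply Rmax_l; reflexivity. Qed.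

Lemma M_real_cont kap u : continuous (M_real kap) u.
Proof.
  apply cont_eps; intros eps He.
  assert (He3 : 0 < eps / 3) by lra.
  destruct (weight_prim_near_half kap (eps / 3) He3) as [R [HR1 HR2]].
  assert (HRR := HR2 R ltac:(lra)).
  assert (C : continuous (fun u => M_trunc kap R (Rmax 0 u)) u).
  { apply (cont_comp (M_trunc kap R)); [apply Rmax0_cont|].
    apply cont_RInt_upper; intros; apply K_trunc_cont; lra. }
  destruct (proj1 (cont_eps _ _) C (eps / 3) He3) as [d [Hd HC]].
  exists d; split; auto; intros v Hv.
  assert (Hv' := HC v Hv).
  rewrite (M_real_max kap v), (M_real_max kap u).
  assert (K1 := M_real_rate kap (Rmax 0 v) R (Rmax_l _ _) HR1).
  assert (K2 := M_real_rate kap (Rmax 0 u) R (Rmax_l _ _) HR1).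
  apply Rabs_def2 in Hv'; apply Rabs_le_between in K1; apply Rabs_le_between in K2.
  apply Rabs_def1; lra.
Qed.

Lemma M_real_0 kap : M_real kap 0 = 0.
Proof.
  assert (H : forall eps, 0 < eps -> Rabs (M_real kap 0) < eps).
  { intros eps He; destruct (weight_prim_near_half kap eps He) as [R [HR1 HR2]].
    assert (K := M_real_rate kap 0 R ltac:(lra) HR1).
    unfold M_trunc in K; rewrite RInt_Rpoint, Rminus_0_r in K.
    assert (HRR := HR2 R ltac:(lra)); lra. }
  destruct (Req_dec (M_real kap 0) 0) as [E|E]; auto.
  assert (K := H _ (Rabs_pos_lt _ E)); lra.
Qed.

(** The identity holds for the truncations by definition and passes to the limit, as [K_trunc]
    converges uniformly on [[a, b]]. *)
Lemma M_real_diff kap a b : 0 < a <= b -> M_real kap b - M_real kap a = RInt (K_real kap) a b.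
Proof.
  intros Hab.
  assert (IK : ex_RInt (K_real kap) a b) by (apply ex_RInt_cont_on; [lra|]; intros; apply K_real_cont; lra).
  apply Rminus_diag_uniq, Rabs_eq_0.
  apply Rle_antisym; [|apply Rabs_pos]; apply le_epsilon; intros eps He.
  assert (He4 : 0 < eps / 4) by lra.
  destruct (weight_prim_near_half kap (eps / 4) He4) as [R0 [HR1 HR2]].
  assert (H := lim_exp_decay a ((b - a) * (2 / a)) ltac:(lra)); apply is_lim_spec in H.
  destruct (H (mkposreal (eps / 4) He4)) as [A HA]; simpl in HA.
  set (R := Rmax R0 (A + 1)).
  assert (H1 := Rmax_l R0 (A + 1)); assert (H2 := Rmax_r R0 (A + 1)); fold R in H1, H2.
  assert (H3 := HA R ltac:(lra)); rewrite Rminus_0_r in H3; apply Rabs_def2 in H3.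
  assert (HRR := HR2 R H1).
  assert (K1 := M_real_rate kap a R ltac:(lra) ltac:(lra)).
  assert (K2 := M_real_rate kap b R ltac:(lra) ltac:(lra)).
  assert (CK : forall x, continuous (K_trunc kap R) x) by (intros; apply K_trunc_cont; lra).
  assert (K3 : M_trunc kap R b - M_trunc kap R a = RInt (K_trunc kap R) a b).
  { apply RInt_diff; apply ex_RInt_cont; auto. }
  assert (K4 : Rabs (RInt (fun u => K_real kap u - K_trunc kap R u) a b) <= (b - a) * (2 / a * exp (- (a * R)))).
  { apply RInt_abs_le_const; [lra|apply ex_RInt_Rminus; auto; apply ex_RInt_cont; auto|].
    intros u Hu; eapply Rle_trans; [apply K_real_rate; lra|].
    apply Rmult_le_compat; [left; apply Rdiv_lt_0_compat; lra|left; apply exp_pos| |].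
    - apply Rmult_le_compat_l; [lra|apply Rinv_le_contravar; lra].
    - apply exp_le; nra. }
  rewrite RInt_Rminus in K4 by (auto; apply ex_RInt_cont; auto).
  rewrite <- Rmult_assoc in K4.
  apply Rabs_le_between in K1; apply Rabs_le_between in K2; apply Rabs_le_between in K4.
  apply Rabs_le; lra.
Qed.

Lemma M_real_deriv kap u : 0 < u -> is_derive (M_real kap) u (K_real kap u).
Proof.
  intros Hu.
  assert (HL : locally u (fun z => u / 2 < z)) by (apply open_gt; lra).
  apply is_derive_ext_loc with (fun z => M_real kap (u / 2) + RInt (K_real kap) (u / 2) z).
  - apply (filter_imp (fun z => u / 2 < z)); auto.
    intros z Hz; rewrite <- M_real_diff by lra; apply Rplus_minus.
  - evar_last.
    + apply (is_derive_plus (V := R_NormedModule)); [apply is_derive_const|].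
      apply (is_derive_RInt (V := R_NormedModule) (K_real kap) _ (u / 2)); [|apply K_real_cont; auto].
      apply (filter_imp (fun z => u / 2 < z)); auto.
      intros z Hz; apply (RInt_correct (V := R_CompleteNormedModule)).
      apply ex_RInt_cont_on; [lra|]; intros; apply K_real_cont; lra.
    + apply (plus_zero_l (G := R_AbelianGroup)).
Qed.

Lemma M_real_le kap a b : 0 < a <= b -> M_real kap a <= M_real kap b.
Proof.
  intros H; enough (0 <= M_real kap b - M_real kap a) by lra.
  rewrite M_real_diff by auto; apply RInt_nonneg; [lra| |intros; apply K_real_ge0; lra].
  apply ex_RInt_cont_on; [lra|]; intros; apply K_real_cont; lra.
Qed.

(** * Deformation of the contour *)

(* Real and imaginary part of [exp (i phi + s r exp (i phi)) / (ln r + 2 kap + i phi)]. *)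
Definition ReF (kap s r phi : R) :=
  exp (s * r * cos phi) *
  (cos (phi + s * r * sin phi) * ln_shift kap r + sin (phi + s * r * sin phi) * phi)
  / (ln_shift kap r ^ 2 + phi ^ 2).
Definition ImF (kap s r phi : R) :=
  exp (s * r * cos phi) *
  (sin (phi + s * r * sin phi) * ln_shift kap r - cos (phi + s * r * sin phi) * phi)
  / (ln_shift kap r ^ 2 + phi ^ 2).
(* [F] being analytic in [ln r + i phi], both [d/dr (r Re F)] and [d/dphi (Im F)] equal [dF]. *)
Definition dF (kap s r phi : R) :=
  ReF kap s r phi * (1 + s * r * cos phi - ln_shift kap r / (ln_shift kap r ^ 2 + phi ^ 2)) -
  ImF kap s r phi * (s * r * sin phi + phi / (ln_shift kap r ^ 2 + phi ^ 2)).

Lemma den_pos x phi : 0 < phi -> 0 < x ^ 2 + phi ^ 2.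
Proof. intros H; assert (0 <= x ^ 2) by apply pow2_ge_0; nra. Qed.

Lemma rReF_deriv kap s r phi : 0 < r -> 0 < phi ->
  is_derive (fun r => r * ReF kap s r phi) r (dF kap s r phi).
Proof.
  intros Hr Hphi; assert (Hd := den_pos (ln_shift kap r) phi Hphi).
  unfold dF, ReF, ImF, ln_shift in *; auto_derive.
  - repeat split; auto; lra.
  - field; repeat split; lra.
Qed.

Lemma ImF_deriv kap s r phi : 0 < r -> 0 < phi ->
  is_derive (ImF kap s r) phi (dF kap s r phi).
Proof.
  intros Hr Hphi; assert (Hd := den_pos (ln_shift kap r) phi Hphi).
  unfold dF, ReF, ImF in *; auto_derive.
  - repeat split; auto; lra.
  - field; repeat split; lra.
Qed.

Lemma cont2_ln_shift kap r (phi : R) : 0 < r -> continuous (fun z : R * R => ln_shift kap (fst z)) (r, phi).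
Proof. intros H; apply (cont_comp (ln_shift kap)); [cont|apply ln_shift_cont; auto]. Qed.

Lemma ReF_cont2 kap s r phi : 0 < r -> 0 < phi -> cont2 (ReF kap s) r phi.
Proof.
  intros Hr Hphi; assert (Hd := den_pos (ln_shift kap r) phi Hphi); assert (C := cont2_ln_shift kap r phi Hr).
  unfold cont2, ReF; cont; simpl in *; lra.
Qed.

Lemma ImF_cont2 kap s r phi : 0 < r -> 0 < phi -> cont2 (ImF kap s) r phi.
Proof.
  intros Hr Hphi; assert (Hd := den_pos (ln_shift kap r) phi Hphi); assert (C := cont2_ln_shift kap r phi Hr).
  unfold cont2, ImF; cont; simpl in *; lra.
Qed.

Lemma dF_cont2 kap s r phi : 0 < r -> 0 < phi -> cont2 (dF kap s) r phi.
Proof.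
  intros Hr Hphi; assert (Hd := den_pos (ln_shift kap r) phi Hphi); assert (C := cont2_ln_shift kap r phi Hr).
  assert (C1 := ReF_cont2 kap s r phi Hr Hphi); assert (C2 := ImF_cont2 kap s r phi Hr Hphi).
  unfold cont2 in *; unfold dF; cont; simpl in *; lra.
Qed.

(* Cauchy's theorem on the quarter annulus [a <= r <= b], [PI/2 <= phi <= PI] *)
Lemma contour_identity kap s a b : 0 < a <= b ->
  RInt (fun r => ImF kap s r PI) a b - RInt (fun r => ImF kap s r (PI / 2)) a b =
  RInt (fun phi => b * ReF kap s b phi - a * ReF kap s a phi) (PI / 2) PI.
Proof.
  intros Hab; assert (Hp := PI_RGT_0).
  rewrite <- RInt_Rminus.
  2, 3: apply ex_RInt_cont_on; [lra|]; intros; apply (cont2_left (ImF kap s)), ImF_cont2; lra.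
  transitivity (RInt (fun r => RInt (fun phi => dF kap s r phi) (PI / 2) PI) a b).
  - apply RInt_ext_on; [lra|]; intros r Hr; symmetry; apply RInt_FTC; [lra| |].
    + intros; apply ImF_deriv; lra.
    + intros; apply (cont2_right (dF kap s)), dF_cont2; lra.
  - rewrite (Fubini (dF kap s)); [|lra|lra|intros; apply dF_cont2; lra].
    apply RInt_ext_on; [lra|]; intros phi Hphi.
    apply (RInt_FTC (fun r => r * ReF kap s r phi)); [lra| |].
    + intros; apply rReF_deriv; lra.
    + intros; apply (cont2_left (dF kap s)), dF_cont2; lra.
Qed.

(** Jordan's inequality with the weaker constant [1 / 3]: [sin x >= x - x ^ 3 / 6 >= x / 3] for
    [0 <= x <= 2], and [PI / 2 <= 2]. *)
Lemma cos_jordan phi : PI / 2 <= phi <= PI -> cos phi <= - (phi - PI / 2) / 3.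
Proof.
  intros H; set (x := phi - PI / 2).
  replace phi with (PI / 2 + x) by (unfold x; ring).
  replace (cos (PI / 2 + x)) with (- sin x) by (rewrite sin_cos; ring).
  assert (Hx : 0 <= x <= 2) by (unfold x; assert (P := PI_4); lra).
  assert (Hs : x - x ^ 3 / 6 <= sin x).
  { destruct (pre_sin_bound x 0) as [Hb _]; [lra|lra|].
    eapply Rle_trans; [|apply Hb]; unfold sin_approx, sin_term; simpl; lra. }
  assert (x ^ 3 / 6 <= 2 / 3 * x); [|lra].
  replace (x ^ 3 / 6) with (x * x / 6 * x) by (simpl; field).
  apply Rmult_le_compat_r; nra.
Qed.

(** The factor [c] is left free because the two arcs differ: it is [2 / ln_shift kap R] on the large
    arc and 2 on the small one. *)
Lemma ReF_bound kap s r phi c : 0 <= s * r -> PI / 2 <= phi <= PI ->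
  Rabs (ln_shift kap r) + phi <= c * (ln_shift kap r ^ 2 + phi ^ 2) ->
  Rabs (ReF kap s r phi) <= exp (- (s * r * ((phi - PI / 2) / 3))) * c.
Proof.
  intros Hsr Hphi Hc; assert (Hp := PI_RGT_0).
  assert (Hd := den_pos (ln_shift kap r) phi ltac:(lra)).
  unfold ReF, Rdiv; rewrite !Rabs_mult, Rmult_assoc.
  rewrite (Rabs_pos_eq (exp _)) by (left; apply exp_pos).
  assert (He : exp (s * r * cos phi) <= exp (- (s * r * ((phi - PI / 2) / 3)))).
  { apply exp_le; assert (H := cos_jordan phi Hphi); nra. }
  apply Rmult_le_compat; auto.
  - left; apply exp_pos.
  - apply Rmult_le_pos; apply Rabs_pos.
  - rewrite (Rabs_pos_eq (/ _)) by (left; apply Rinv_0_lt_compat; auto).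
    apply (Rmult_le_reg_r (ln_shift kap r ^ 2 + phi ^ 2)); auto.
    rewrite Rmult_assoc, Rinv_l, Rmult_1_r by lra.
    eapply Rle_trans; [|apply Hc].
    eapply Rle_trans; [apply Rabs_triang|]; rewrite !Rabs_mult.
    set (psi := phi + s * r * sin phi).
    assert (Rabs (cos psi) <= 1) by (apply Rabs_le; split; apply COS_bound).
    assert (Rabs (sin psi) <= 1) by (apply Rabs_le; split; apply SIN_bound).
    rewrite (Rabs_pos_eq phi) by lra.
    assert (0 <= Rabs (ln_shift kap r)) by apply Rabs_pos; nra.
Qed.

(** On the large arc the angular decay integrates to at most [3 / (s R)], against the factor
    [R * 2 / ln_shift kap R]; on the small arc the integrand is at most [2 / R] over an angle
    [PI / 2]. *)
Lemma contour_bound kap s R : 0 < s -> 1 <= R -> 4 <= ln_shift kap R ->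
  Rabs (RInt (fun r => ImF kap s r PI) (/ R) R - RInt (fun r => ImF kap s r (PI / 2)) (/ R) R)
  <= 6 / (s * ln_shift kap R) + 4 / R.
Proof.
  intros Hs HR HL; assert (H3 := PI_gt3); assert (H4 := PI_4).
  assert (Hi : 0 < / R <= 1) by (split; [apply Rinv_0_lt_compat; lra|rewrite <- Rinv_1; apply Rinv_le_contravar; lra]).
  rewrite contour_identity by lra.
  assert (CR : forall r, 0 < r -> ex_RInt (fun phi => r * ReF kap s r phi) (PI / 2) PI).
  { intros r Hr; apply ex_RInt_cont_on; [lra|]; intros; apply cont_mult; [cont|].
    apply (cont2_right (ReF kap s)), ReF_cont2; lra. }
  rewrite RInt_Rminus by (apply CR; lra).
  eapply Rle_trans; [apply Rabs_triang|]; rewrite Rabs_Ropp; apply Rplus_le_compat.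
  - set (a := s * R / 3); assert (Ha : 0 < a) by (unfold a; nra).
    assert (Hc : 0 < R * (2 / ln_shift kap R)) by (apply Rmult_lt_0_compat; [lra|apply Rdiv_lt_0_compat; lra]).
    apply Rle_trans with (RInt (fun phi => R * (2 / ln_shift kap R) * exp (- (a * (phi - PI / 2)))) (PI / 2) PI).
    + apply RInt_abs_le; [lra|apply CR; lra|apply ex_RInt_cont; intros; cont|].
      intros phi Hphi; rewrite Rabs_mult, (Rabs_pos_eq R), Rmult_assoc by lra.
      apply Rmult_le_compat_l; [lra|].
      eapply Rle_trans; [apply (ReF_bound _ _ _ _ (2 / ln_shift kap R)); [nra|lra|]|].
      * rewrite Rabs_pos_eq by lra.
        apply (Rmult_le_reg_r (ln_shift kap R)); [lra|].
        replace (2 / ln_shift kap R * (ln_shift kap R ^ 2 + phi ^ 2) * ln_shift kap R)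
          with (2 * (ln_shift kap R ^ 2 + phi ^ 2)) by (field; lra).
        nra.
      * rewrite Rmult_comm; right; do 2 f_equal; unfold a; field.
    + rewrite (RInt_FTC (fun phi => - (R * (2 / ln_shift kap R) / a) * exp (- (a * (phi - PI / 2))))); [|lra| |intros; cont].
      * rewrite Rminus_diag, Rmult_0_r, Ropp_0, exp_0.
        assert (He := exp_pos (- (a * (PI - PI / 2)))).
        assert (0 < R * (2 / ln_shift kap R) / a) by (apply Rdiv_lt_0_compat; auto).
        apply Rle_trans with (R * (2 / ln_shift kap R) / a); [nra|].
        right; unfold a; field; lra.
      * intros x _; auto_derive; [auto|]; change (x + - (PI / 2)) with (x - PI / 2); field; lra.
  - apply Rle_trans with ((PI - PI / 2) * (/ R * 2)); [|unfold Rdiv; nra].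
    apply RInt_abs_le_const; [lra|apply CR; lra|]; intros phi Hphi.
    rewrite Rabs_mult, (Rabs_pos_eq (/ R)) by lra.
    apply Rmult_le_compat_l; [lra|].
    assert (Hsr : 0 <= s * / R) by nra.
    eapply Rle_trans; [apply (ReF_bound _ _ _ _ 2); [auto|lra|]|].
    + rewrite <- (pow2_abs (ln_shift kap (/ R))); assert (0 <= (Rabs (ln_shift kap (/ R)) - 1) ^ 2) by apply pow2_ge_0; nra.
    + assert (exp (- (s * / R * ((phi - PI / 2) / 3))) <= 1); [|lra].
      apply Rle_trans with (exp 0); [apply exp_le; nra|rewrite exp_0; lra].
Qed.

(** * The integrand on the imaginary axis *)

Definition q1 (kap y : R) := if Rlt_dec 0 y then ln_shift kap y / (ln_shift kap y ^ 2 + (PI / 2) ^ 2) else 0.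
(** [q1] and [- q2] are the real and imaginary parts of [1 / (ln_shift + i PI / 2)]. Both tend to 0
    at [y = 0], so the extension by 0 is continuous. *)
Definition q2 (kap y : R) := if Rlt_dec 0 y then PI / 2 / (ln_shift kap y ^ 2 + (PI / 2) ^ 2) else 0.

Lemma q1_pos kap y : 0 < y -> q1 kap y = ln_shift kap y / (ln_shift kap y ^ 2 + (PI / 2) ^ 2).
Proof. intros H; unfold q1; destruct Rlt_dec; lra. Qed.

Lemma q2_pos kap y : 0 < y -> q2 kap y = PI / 2 / (ln_shift kap y ^ 2 + (PI / 2) ^ 2).
Proof. intros H; unfold q2; destruct Rlt_dec; lra. Qed.

Lemma q1_cont kap y : continuous (q1 kap) y.
Proof.
  assert (H := PI_gt3); apply (log_vanishing_cont kap).
  - intros z Hz; unfold q1; destruct Rlt_dec; lra.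
  - intros z Hz; apply continuous_ext_loc with (fun y => ln_shift kap y / (ln_shift kap y ^ 2 + (PI / 2) ^ 2)).
    + apply (filter_imp (fun y => 0 < y)); [|apply open_gt; auto].
      intros t Ht; symmetry; apply q1_pos; auto.
    + assert (Hd := den_pos (ln_shift kap z) (PI / 2) ltac:(lra)); assert (C := ln_shift_cont kap z Hz).
      apply cont_div; auto; [lra|]; apply cont_plus; [apply cont_pow; auto|cont].
  - intros z Hz Hl; rewrite q1_pos by auto.
    assert (Hd := den_pos (ln_shift kap z) (PI / 2) ltac:(lra)).
    unfold Rdiv at 1; rewrite Rabs_mult, Rabs_left, Rabs_pos_eq by (auto; left; apply Rinv_0_lt_compat; auto).
    apply (Rmult_le_reg_r (ln_shift kap z ^ 2 + (PI / 2) ^ 2)); auto.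
    rewrite Rmult_assoc, Rinv_l, Rmult_1_r by lra.
    apply (Rmult_le_reg_l (- ln_shift kap z)); [lra|].
    rewrite <- Rmult_assoc, Rinv_r, Rmult_1_l by lra; nra.
Qed.

Lemma q2_cont kap y : continuous (q2 kap) y.
Proof.
  assert (H := PI_gt3); apply (log_vanishing_cont kap).
  - intros z Hz; unfold q2; destruct Rlt_dec; lra.
  - intros z Hz; apply continuous_ext_loc with (fun y => PI / 2 / (ln_shift kap y ^ 2 + (PI / 2) ^ 2)).
    + apply (filter_imp (fun y => 0 < y)); [|apply open_gt; auto].
      intros t Ht; symmetry; apply q2_pos; auto.
    + assert (Hd := den_pos (ln_shift kap z) (PI / 2) ltac:(lra)); assert (C := ln_shift_cont kap z Hz).
      apply cont_div; [lra|cont|]; apply cont_plus; [apply cont_pow; auto|cont].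
  - intros z Hz Hl; rewrite q2_pos by auto.
    assert (Hd := den_pos (ln_shift kap z) (PI / 2) ltac:(lra)).
    rewrite Rabs_pos_eq by (left; apply Rdiv_lt_0_compat; lra).
    apply (Rmult_le_reg_r (ln_shift kap z ^ 2 + (PI / 2) ^ 2)); auto.
    unfold Rdiv at 1; rewrite Rmult_assoc, Rinv_l, Rmult_1_r by lra.
    apply (Rmult_le_reg_l (- ln_shift kap z)); [lra|].
    rewrite <- Rmult_assoc, Rinv_r, Rmult_1_l by lra.
    assert (0 <= (ln_shift kap z + PI / 2) ^ 2) by apply pow2_ge_0; nra.
Qed.

(* For [y > 0], [K_re] is [ImF] at [phi = PI / 2], divided by [PI]. *)
Definition K_re (kap s y : R) := / PI * (cos (s * y) * q1 kap y + sin (s * y) * q2 kap y).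
Definition K_im (kap s y : R) := / PI * (sin (s * y) * q1 kap y - cos (s * y) * q2 kap y).

Lemma K_re_cont kap s y : continuous (K_re kap s) y.
Proof. assert (C1 := q1_cont kap y); assert (C2 := q2_cont kap y); unfold K_re; cont. Qed.

Lemma K_im_cont kap s y : continuous (K_im kap s) y.
Proof. assert (C1 := q1_cont kap y); assert (C2 := q2_cont kap y); unfold K_im; cont. Qed.

Lemma K_re_bound kap s y : Rabs (K_re kap s y) <= 1.
Proof.
  assert (H := PI_gt3); unfold K_re.
  assert (B1 : Rabs (q1 kap y) <= 1).
  { unfold q1; destruct Rlt_dec; [|rewrite Rabs_R0; lra].
    assert (Hd := den_pos (ln_shift kap y) (PI / 2) ltac:(lra)).
    unfold Rdiv at 1; rewrite Rabs_mult, (Rabs_pos_eq (/ _)) by (left; apply Rinv_0_lt_compat; auto).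
    apply (Rmult_le_reg_r (ln_shift kap y ^ 2 + (PI / 2) ^ 2)); auto.
    rewrite Rmult_assoc, Rinv_l, Rmult_1_r by lra.
    rewrite <- (pow2_abs (ln_shift kap y)); assert (0 <= (Rabs (ln_shift kap y) - 1) ^ 2) by apply pow2_ge_0; nra. }
  assert (B2 : Rabs (q2 kap y) <= 1).
  { unfold q2; destruct Rlt_dec; [|rewrite Rabs_R0; lra].
    assert (Hd := den_pos (ln_shift kap y) (PI / 2) ltac:(lra)).
    rewrite Rabs_pos_eq by (left; apply Rdiv_lt_0_compat; lra).
    apply (Rmult_le_reg_r (ln_shift kap y ^ 2 + (PI / 2) ^ 2)); auto.
    unfold Rdiv at 1; rewrite Rmult_assoc, Rinv_l, Rmult_1_r by lra.
    assert (0 <= ln_shift kap y ^ 2) by apply pow2_ge_0; nra. }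
  assert (Hi : 0 < / PI <= / 2) by (split; [apply Rinv_0_lt_compat; lra|apply Rinv_le_contravar; lra]).
  rewrite Rabs_mult, (Rabs_pos_eq (/ PI)) by lra.
  assert (T := Rabs_triang (cos (s * y) * q1 kap y) (sin (s * y) * q2 kap y)).
  rewrite !Rabs_mult in T.
  assert (Rabs (cos (s * y)) <= 1) by (apply Rabs_le; split; apply COS_bound).
  assert (Rabs (sin (s * y)) <= 1) by (apply Rabs_le; split; apply SIN_bound).
  assert (0 <= Rabs (q1 kap y)) by apply Rabs_pos; assert (0 <= Rabs (q2 kap y)) by apply Rabs_pos.
  assert (0 <= Rabs (cos (s * y) * q1 kap y + sin (s * y) * q2 kap y)) by apply Rabs_pos.
  assert (Rabs (cos (s * y) * q1 kap y + sin (s * y) * q2 kap y) <= 2) by nra.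
  nra.
Qed.

Lemma ln_sqrt_half y : 0 < y -> ln (sqrt y) = ln y / 2.
Proof.
  intros H; assert (E : ln (sqrt y * sqrt y) = ln y) by (rewrite sqrt_sqrt; lra).
  rewrite ln_mult in E by (apply sqrt_lt_R0; auto); lra.
Qed.

Lemma Clog_polar rho phi : 0 < rho -> - (PI / 2) < phi < PI / 2 ->
  Clog (rho * cos phi, rho * sin phi) = (ln rho, phi).
Proof.
  intros Hr Hphi; assert (Hc := cos_gt_0 phi ltac:(lra) ltac:(lra)).
  unfold Clog; f_equal.
  - f_equal; unfold Cmod; simpl.
    replace (rho * cos phi * (rho * cos phi) + rho * sin phi * (rho * sin phi))
      with (rho * rho * (Rsqr (sin phi) + Rsqr (cos phi))) by (unfold Rsqr; ring).
    rewrite sin2_cos2, Rmult_1_r; apply sqrt_square; lra.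
  - unfold Carg; simpl; destruct Rlt_dec as [_|n]; [|exfalso; apply n; nra].
    replace (rho * sin phi / (rho * cos phi)) with (tan phi) by (unfold tan; field; lra).
    apply atan_tan; lra.
Qed.

Lemma Cmod_imag y : Cmod (0, y) = Rabs y.
Proof.
  unfold Cmod; simpl; rewrite Rmult_0_r, Rplus_0_l; apply sqrt_Rsqr_abs.
Qed.

Lemma K_integrand_pos kap s y : 0 < y -> K_integrand kap s y = (K_re kap s y, K_im kap s y).
Proof.
  intros Hy; assert (Hp := PI_gt3); unfold K_integrand, Csqrt.
  rewrite Cmod_imag, Rabs_pos_eq by lra.
  replace (Carg (0, y)) with (PI / 2)
    by (unfold Carg; simpl; repeat destruct Rlt_dec; try lra).
  rewrite Clog_polar by (try apply sqrt_lt_R0; lra).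
  rewrite ln_sqrt_half by auto.
  assert (Hd := den_pos (ln_shift kap y) (PI / 2) ltac:(lra)).
  unfold K_re, K_im; rewrite q1_pos, q2_pos by auto.
  unfold Cmul, Cinv, Cexp, Cadd, RtoC, Ci, ln_shift in *; simpl fst; simpl snd.
  replace (s * 0 - 0 * y) with 0 by ring; replace (s * y + 0 * 0) with (s * y) by ring.
  rewrite exp_0; f_equal; field; repeat split; nra.
Qed.

(** The value at [y] is the conjugate of that at [- y]; therefore integrals over [[- R, R]] are
    real. *)
Lemma K_integrand_neg kap s y : y < 0 -> K_integrand kap s y = (K_re kap s (- y), - K_im kap s (- y)).
Proof.
  intros Hy; assert (Hp := PI_gt3); unfold K_integrand, Csqrt.
  rewrite Cmod_imag, Rabs_left by lra.
  replace (Carg (0, y)) with (- (PI / 2))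
    by (unfold Carg; simpl; repeat destruct Rlt_dec; try lra).
  rewrite Clog_polar by (try apply sqrt_lt_R0; lra).
  rewrite ln_sqrt_half by lra.
  assert (Hd := den_pos (ln_shift kap (- y)) (PI / 2) ltac:(lra)).
  unfold K_re, K_im; rewrite q1_pos, q2_pos by lra.
  unfold Cmul, Cinv, Cexp, Cadd, RtoC, Ci, ln_shift in *; simpl fst; simpl snd.
  replace (s * 0 - 0 * y) with 0 by ring; replace (s * y + 0 * 0) with (- (s * - y)) by ring.
  rewrite cos_neg, sin_neg.
  rewrite exp_0; f_equal; field; repeat split; nra.
Qed.

Lemma RInt_negate (f : R -> R) R : (forall x, continuous f x) ->
  RInt (fun y => f (- y)) (- R) 0 = RInt f 0 R.
Proof.
  intros C.
  assert (H := RInt_affine f (-1) 0 (- R) 0 C).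
  replace (-1 * - R + 0) with R in H by ring.
  replace (-1 * 0 + 0) with 0 in H by ring.
  rewrite (RInt_Rswap f 0 R C), RInt_Rscal in H.
  - rewrite (RInt_ext (fun y => f (- y)) (fun y => f (-1 * y + 0))) by (intros; f_equal; ring).
    lra.
  - apply ex_RInt_cont; intros x; apply (cont_comp f); auto; cont.
Qed.

Lemma K_integral kap s R : 0 < R ->
  is_CInt (K_integrand kap s) (- R) R (RtoC (2 * RInt (K_re kap s) 0 R)).
Proof.
  intros HR; split; unfold RtoC; cbn [fst snd].
  - assert (E1 : ex_RInt (fun x => fst (K_integrand kap s x)) (- R) 0).
    { apply ex_RInt_ext_on with (fun y => K_re kap s (- y)); [lra| |].
      - intros; cbv beta; rewrite K_integrand_neg by lra; reflexivity.
      - apply ex_RInt_cont; intros; apply (cont_comp (K_re kap s)); [cont|apply K_re_cont]. }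
    assert (E2 : ex_RInt (fun x => fst (K_integrand kap s x)) 0 R).
    { apply ex_RInt_ext_on with (K_re kap s); [lra| |apply ex_RInt_cont, K_re_cont].
      intros; cbv beta; rewrite K_integrand_pos by lra; reflexivity. }
    apply RInt_to_is_RInt; [apply (ex_RInt_Chasles (V := R_NormedModule)) with 0; auto|].
    rewrite (RInt_split _ (- R) 0 R) by auto.
    rewrite (RInt_ext_on _ (fun y => K_re kap s (- y)) (- R) 0); [|lra|intros; cbv beta; rewrite K_integrand_neg by lra; reflexivity].
    rewrite (RInt_ext_on _ (K_re kap s) 0 R); [|lra|intros; cbv beta; rewrite K_integrand_pos by lra; reflexivity].
    rewrite RInt_negate by apply K_re_cont; lra.
  - assert (E1 : ex_RInt (fun x => snd (K_integrand kap s x)) (- R) 0).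
    { apply ex_RInt_ext_on with (fun y => - K_im kap s (- y)); [lra| |].
      - intros; cbv beta; rewrite K_integrand_neg by lra; reflexivity.
      - apply ex_RInt_cont; intros; apply cont_opp, (cont_comp (K_im kap s)); [cont|apply K_im_cont]. }
    assert (E2 : ex_RInt (fun x => snd (K_integrand kap s x)) 0 R).
    { apply ex_RInt_ext_on with (K_im kap s); [lra| |apply ex_RInt_cont, K_im_cont].
      intros; cbv beta; rewrite K_integrand_pos by lra; reflexivity. }
    apply RInt_to_is_RInt; [apply (ex_RInt_Chasles (V := R_NormedModule)) with 0; auto|].
    rewrite (RInt_split _ (- R) 0 R) by auto.
    rewrite (RInt_ext_on _ (fun y => -1 * K_im kap s (- y)) (- R) 0);
      [|lra|intros; cbv beta; rewrite K_integrand_neg by lra; simpl; ring].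
    rewrite (RInt_ext_on _ (K_im kap s) 0 R); [|lra|intros; cbv beta; rewrite K_integrand_pos by lra; reflexivity].
    rewrite RInt_Rscal by (apply ex_RInt_cont; intros; apply (cont_comp (K_im kap s)); [cont|apply K_im_cont]).
    rewrite RInt_negate by apply K_im_cont; lra.
Qed.

(** The contour cannot pass through [zeta = 0], so [[0, 1 / R]] is split off on both rays; the
    integrands are bounded by 1 and 2 there, which costs [4 / R] beyond [contour_bound]. *)
Lemma K_integral_rate kap s R : 0 < s -> 1 <= R -> 4 <= ln_shift kap R ->
  Rabs (2 * RInt (K_re kap s) 0 R - K_trunc kap R s) <= 6 / (s * ln_shift kap R) + 8 / R.
Proof.
  intros Hs HR HL; assert (H3 := PI_gt3).
  assert (Hi : 0 < / R <= 1) by (split; [apply Rinv_0_lt_compat; lra|rewrite <- Rinv_1; apply Rinv_le_contravar; lra]).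
  unfold K_trunc.
  rewrite (RInt_split (K_re kap s) 0 (/ R) R) by (apply ex_RInt_cont, K_re_cont).
  rewrite (RInt_split (K_ker kap s) 0 (/ R) R) by apply K_ker_int.
  assert (B1 : Rabs (RInt (K_re kap s) 0 (/ R)) <= (/ R - 0) * 1)
    by (apply RInt_abs_le_const; [lra|apply ex_RInt_cont, K_re_cont|intros; apply K_re_bound]).
  assert (B2 : Rabs (RInt (K_ker kap s) 0 (/ R)) <= (/ R - 0) * 2).
  { apply RInt_abs_le_const; [lra|apply K_ker_int|]; intros y Hy.
    rewrite Rabs_pos_eq by apply K_ker_ge0; unfold K_ker.
    assert (exp (- (s * y)) <= 1) by (apply Rle_trans with (exp 0); [apply exp_le; nra|rewrite exp_0; lra]).
    assert (E0 := exp_pos (- (s * y))); assert (W0 := weight_ge0 kap y); assert (W1 := weight_le1 kap y); nra. }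
  assert (I1 : ex_RInt (fun r => ImF kap s r (PI / 2)) (/ R) R).
  { apply ex_RInt_cont_on; [lra|]; intros; apply (cont2_left (ImF kap s)), ImF_cont2; lra. }
  assert (I2 : ex_RInt (fun r => ImF kap s r PI) (/ R) R).
  { apply ex_RInt_cont_on; [lra|]; intros; apply (cont2_left (ImF kap s)), ImF_cont2; lra. }
  assert (E1 : RInt (K_re kap s) (/ R) R = / PI * RInt (fun r => ImF kap s r (PI / 2)) (/ R) R).
  { rewrite <- RInt_Rscal by auto; apply RInt_ext_on; [lra|]; intros r Hr.
    unfold K_re, ImF; rewrite q1_pos, q2_pos by lra.
    rewrite cos_PI2, sin_PI2, Rmult_0_r, exp_0, !Rmult_1_r.
    replace (sin (PI / 2 + s * r)) with (cos (s * r)) by (rewrite cos_sin; reflexivity).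
    replace (cos (PI / 2 + s * r)) with (- sin (s * r)) by (rewrite sin_cos; ring).
    assert (Hd := den_pos (ln_shift kap r) (PI / 2) ltac:(lra)); field; nra. }
  (* At [phi = PI] the sine vanishes and [ImF] reduces to [PI * exp (- s r) * weight r]. *)
  assert (E2 : RInt (K_ker kap s) (/ R) R = 2 / PI * RInt (fun r => ImF kap s r PI) (/ R) R).
  { rewrite <- RInt_Rscal by auto; apply RInt_ext_on; [lra|]; intros r Hr.
    unfold K_ker, ImF; rewrite weight_pos by lra.
    rewrite cos_PI, sin_PI, Rmult_0_r, Rplus_0_r, cos_PI, sin_PI.
    replace (s * r * -1) with (- (s * r)) by ring.
    assert (Hd := den_pos (ln_shift kap r) PI ltac:(lra)); field; nra. }
  rewrite E1, E2.
  assert (B := contour_bound kap s R Hs HR HL).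
  set (X := RInt (fun r => ImF kap s r (PI / 2)) (/ R) R) in *.
  set (Y := RInt (fun r => ImF kap s r PI) (/ R) R) in *.
  set (A := RInt (K_re kap s) 0 (/ R)) in *; set (D := RInt (K_ker kap s) 0 (/ R)) in *.
  replace (2 * (A + / PI * X) - (D + 2 / PI * Y)) with (2 * A + (- D + - (2 / PI) * (Y - X))) by (field; lra).
  eapply Rle_trans; [apply Rabs_triang|]; rewrite Rabs_mult, (Rabs_pos_eq 2) by lra.
  assert (T := Rabs_triang (- D) (- (2 / PI) * (Y - X))); rewrite Rabs_Ropp in T.
  rewrite Rabs_mult, Rabs_Ropp in T.
  assert (Hq : 0 < 2 / PI <= 1).
  { split; [apply Rdiv_lt_0_compat; lra|].
    apply (Rmult_le_reg_r PI); [lra|]; unfold Rdiv; rewrite Rmult_assoc, Rinv_l; lra. }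
  rewrite (Rabs_pos_eq (2 / PI)) in T by lra.
  assert (0 <= Rabs (Y - X)) by apply Rabs_pos.
  unfold Rdiv in *; nra.
Qed.

Lemma K_lim_K_real kap s : 0 < s -> K_lim kap s (RtoC (K_real kap s)).
Proof.
  intros Hs eps He.
  assert (L1 := lim_ln_shift kap); apply is_lim_spec in L1.
  (* The 24 here and the 32 below bring [6 / (s * ln_shift kap R)] and [8 / R] under [eps / 4]; the
     4 is required by [contour_bound]. *)
  destruct (L1 (Rmax 4 (24 / (s * eps)))) as [A1 HA1].
  assert (L2 := lim_exp_decay s (2 / s) Hs); apply is_lim_spec in L2.
  assert (He4 : 0 < eps / 4) by lra.
  destruct (L2 (mkposreal _ He4)) as [A2 HA2]; simpl in HA2.
  exists (Rmax (Rmax A1 A2) (Rmax 1 (32 / eps))); intros R HR.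
  assert (M1 := Rmax_l (Rmax A1 A2) (Rmax 1 (32 / eps))); assert (M2 := Rmax_r (Rmax A1 A2) (Rmax 1 (32 / eps))).
  assert (M3 := Rmax_l A1 A2); assert (M4 := Rmax_r A1 A2).
  assert (M5 := Rmax_l 1 (32 / eps)); assert (M6 := Rmax_r 1 (32 / eps)).
  assert (H1 := HA1 R ltac:(lra)); assert (H2 := HA2 R ltac:(lra)).
  assert (M7 := Rmax_l 4 (24 / (s * eps))); assert (M8 := Rmax_r 4 (24 / (s * eps))).
  rewrite Rminus_0_r in H2; apply Rabs_def2 in H2.
  exists (RtoC (2 * RInt (K_re kap s) 0 R)); split; [apply K_integral; lra|].
  rewrite Cmod_re by (simpl; ring); simpl.
  assert (B1 := K_integral_rate kap s R Hs ltac:(lra) ltac:(lra)).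
  assert (B2 := K_real_rate kap s R Hs ltac:(lra)).
  assert (B3 : 6 / (s * ln_shift kap R) < eps / 4).
  { assert (Hl : 24 / (s * eps) < ln_shift kap R) by lra.
    apply (Rmult_lt_compat_r (s * eps)) in Hl; [|nra].
    unfold Rdiv at 1 in Hl; rewrite Rmult_assoc, Rinv_l in Hl by nra.
    apply (Rmult_lt_reg_r (s * ln_shift kap R)); [nra|].
    unfold Rdiv at 1; rewrite Rmult_assoc, Rinv_l by nra; nra. }
  assert (B4 : 8 / R < eps / 4).
  { assert (Hl : 32 / eps < R) by lra.
    apply (Rmult_lt_compat_r eps) in Hl; [|lra].
    unfold Rdiv at 1 in Hl; rewrite Rmult_assoc, Rinv_l in Hl by lra.
    apply (Rmult_lt_reg_r R); [lra|].
    unfold Rdiv at 1; rewrite Rmult_assoc, Rinv_l by lra; lra. }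
  apply Rabs_le_between in B1; apply Rabs_le_between in B2; apply Rabs_def1; lra.
Qed.

(** * The trace *)

(* [NEs x] extends [NEp x] by [0] to [r <= 0] in a continuously differentiable way. *)
Definition NEs (x r : R) := sqrt x / x ^ 2 * prof (r / x ^ 2).
Definition NEs' (x r : R) := sqrt x / x ^ 4 * prof' (r / x ^ 2).

Lemma NEp_NEs x r : 0 < x -> 0 < r -> NEp x r = NEs x r.
Proof.
  intros Hx Hr; unfold NEp, NEs, prof.
  assert (Hx2 : 0 < x ^ 2) by (apply pow_lt; auto).
  rewrite flat_pos by (apply Rdiv_lt_0_compat; auto).
  replace (- x ^ 2 / (4 * r)) with (- / (4 * (r / x ^ 2))) by (field; lra).
  field; lra.
Qed.

Lemma NEs_deriv x r : 0 < x -> is_derive (NEs x) r (NEs' x r).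
Proof.
  intros Hx; unfold NEs.
  evar_last; [apply is_derive_scal, (is_derive_comp prof (fun r => r / x ^ 2)); [apply prof_deriv|]|].
  - auto_derive; [auto|reflexivity].
  - unfold NEs', scal; simpl; unfold mult; simpl; field; lra.
Qed.

Lemma NEs_cont x r : 0 < x -> continuous (NEs x) r.
Proof. intros Hx; apply (cont_deriv _ _ _ (NEs_deriv x r Hx)). Qed.

Lemma NEs'_cont x r : 0 < x -> continuous (NEs' x) r.
Proof.
  intros Hx; unfold NEs'; apply cont_mult; [cont|].
  assert (0 < x ^ 2) by (apply pow_lt; auto).
  apply (cont_comp prof'); [cont; lra|apply prof'_cont].
Qed.

Lemma div_sq_le0 x r : 0 < x -> r <= 0 -> r / x ^ 2 <= 0.
Proof.
  intros Hx Hr; assert (0 < / x ^ 2) by (apply Rinv_0_lt_compat, pow_lt; auto).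
  unfold Rdiv; nra.
Qed.

Lemma NEs_neg x r : 0 < x -> r <= 0 -> NEs x r = 0.
Proof. intros Hx Hr; unfold NEs; rewrite prof_neg by (apply div_sq_le0; auto); ring. Qed.

Lemma NEs'_neg x r : 0 < x -> r <= 0 -> NEs' x r = 0.
Proof. intros Hx Hr; unfold NEs'; rewrite prof'_neg by (apply div_sq_le0; auto); ring. Qed.

(** The inner integral after integration by parts and [u = s - r]. As [NEs' x] vanishes on negative
    arguments, the upper bound can be [t] instead of [s], which puts the double integral on a
    square. *)
Definition trace_g (kap x t s : R) := NEs x (t - s) * RInt (fun u => NEs' x (s - u) * M_real kap u) 0 t.
Definition trace_h (kap x t : R) := RInt (trace_g kap x t) 0 t.
(* [trace_h_ker] is minus the [x]-derivative of [trace_prim_ker]; for [c > 0] this is visible after writing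
   the latter with [prof_conv (c / x ^ 2) / c]. *)
Definition trace_h_ker (kap t x c : R) := M_real kap (t - c) * (prof_conv' (c / x ^ 2) / x ^ 3).
Definition trace_prim_ker (kap t x c : R) := M_real kap (t - c) * (/ 2 * flat_mean' (c / x ^ 2) / x ^ 2).
Definition trace_prim (kap t x : R) := RInt (trace_prim_ker kap t x) 0 t.

Lemma trace_g_ker_cont2 kap x s u : 0 < x -> cont2 (fun s u => NEs' x (s - u) * M_real kap u) s u.
Proof.
  intros Hx; unfold cont2; apply cont_mult.
  - apply (cont_comp (NEs' x)); [cont|apply NEs'_cont; auto].
  - apply (cont_comp (M_real kap)); [cont|apply M_real_cont].
Qed.

Lemma trace_g_cont kap x t s : 0 < x -> 0 <= t -> continuous (trace_g kap x t) s.
Proof.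
  intros Hx Ht; unfold trace_g; apply cont_mult.
  - apply (cont_comp (NEs x)); [cont|apply NEs_cont; auto].
  - apply (RInt_param_cont (fun s u => NEs' x (s - u) * M_real kap u)); auto.
    intros; apply trace_g_ker_cont2; auto.
Qed.

Lemma trace_g_ker_restrict kap x t s : 0 < x -> 0 <= s <= t ->
  RInt (fun u => NEs' x (s - u) * M_real kap u) 0 t = RInt (fun r => M_real kap (s - r) * NEs' x r) 0 s.
Proof.
  intros Hx Hs.
  assert (C : forall u, continuous (fun u => NEs' x (s - u) * M_real kap u) u)
    by (intros; apply (cont2_right (fun s u => NEs' x (s - u) * M_real kap u)), trace_g_ker_cont2; auto).
  rewrite (RInt_split _ 0 s t) by (apply ex_RInt_cont, C).
  rewrite (RInt_ext_on _ (fun _ => 0) s t); [|lra|intros; rewrite NEs'_neg by lra; ring].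
  rewrite RInt_Rconst, Rmult_0_r, Rplus_0_r.
  rewrite <- RInt_reflect by apply C; apply RInt_ext_on; [lra|]; intros r Hr.
  replace (s - (s - r)) with r by ring; ring.
Qed.

(** [Z] is the primitive by parts with [E = NEs x]. The boundary terms vanish because [NEs x 0 = 0]
    and [M_real kap 0 = 0]. *)
Lemma inner_integral (K : R -> Cplx) kap x t s :
  (forall u, 0 < u -> K u = RtoC (K_real kap u)) -> 0 < x -> 0 < s < t ->
  is_CInt_open (fun r => Cmul (RtoC (NEp x (t - s) * NEp x r)) (K (s - r))) 0 s
    (RtoC (trace_g kap x t s)).
Proof.
  intros HK Hx Hs.
  set (Z := fun r => RInt (fun c => M_real kap (s - c) * NEs' x c) 0 r - M_real kap (s - r) * NEs x r).
  replace (trace_g kap x t s) with (NEs x (t - s) * Z s - NEs x (t - s) * Z 0).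
  2: { unfold Z, trace_g; rewrite trace_g_ker_restrict by lra.
       rewrite Rminus_diag, M_real_0, RInt_Rpoint, (NEs_neg x 0) by lra; ring. }
  apply (improper_FTC_cont _ (fun r => NEs x (t - s) * (K_real kap (s - r) * NEs x r))
           (fun r => NEs x (t - s) * Z r)); [lra| | | | |].
  - intros r Hr; rewrite HK, !NEp_NEs by lra; unfold Cmul, RtoC; simpl; f_equal; ring.
  - intros r Hr; apply is_derive_scal.
    apply (parts_deriv (M_real kap) (K_real kap) (M_real_cont kap) (M_real_deriv kap) (NEs x) (NEs' x)); [| |lra];
      intros; [apply NEs_deriv|apply NEs'_cont]; auto.
  - intros r Hr; apply cont_mult; [cont|]; apply cont_mult; [|apply NEs_cont; auto].
    apply (cont_comp (K_real kap)); [cont|apply K_real_cont; lra].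
  - apply cont_mult; [cont|].
    apply (parts_cont (M_real kap) (M_real_cont kap) (NEs x) (NEs' x));
      intros; [apply NEs_deriv|apply NEs'_cont]; auto.
  - apply cont_mult; [cont|].
    apply (parts_cont (M_real kap) (M_real_cont kap) (NEs x) (NEs' x));
      intros; [apply NEs_deriv|apply NEs'_cont]; auto.
Qed.

Lemma middle_integral kap x t : 0 < x -> 0 < t ->
  is_CInt_open (fun s => RtoC (trace_g kap x t s)) 0 t (RtoC (trace_h kap x t)).
Proof.
  intros Hx Ht; assert (C : forall s, continuous (trace_g kap x t) s) by (intros; apply trace_g_cont; lra).
  replace (trace_h kap x t) with (RInt (trace_g kap x t) 0 t - RInt (trace_g kap x t) 0 0)
    by (rewrite RInt_Rpoint; apply Rminus_0_r).
  apply (improper_FTC_cont _ (trace_g kap x t) (fun s => RInt (trace_g kap x t) 0 s)); auto.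
  - intros; apply is_derive_RInt_upper, C.
  - apply cont_RInt_upper, C.
  - apply cont_RInt_upper, C.
Qed.

(** Substitute [r = x ^ 2 v]: the prefactors give [x / x ^ 6] and the differential [x ^ 2]. *)
Lemma NEs_conv x t c : 0 < x -> 0 < c < t ->
  RInt (fun r => NEs x r * NEs' x (c - r)) 0 t = prof_conv' (c / x ^ 2) / x ^ 3.
Proof.
  intros Hx Hc; assert (Hx2 : 0 < x ^ 2) by (apply pow_lt; auto).
  assert (Hi : 0 < / x ^ 2) by (apply Rinv_0_lt_compat; auto).
  assert (C : forall v, continuous (fun v => prof v * prof' (c / x ^ 2 - v)) v).
  { intros; apply cont_mult; [apply prof_cont|apply (cont_comp prof'); [cont|apply prof'_cont]]. }
  unfold prof_conv'; rewrite (prof_conv_upper prof' (c / x ^ 2) (/ x ^ 2 * t + 0)); [|apply prof'_cont|apply prof'_neg| |].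
  - assert (H := RInt_affine (fun v => prof v * prof' (c / x ^ 2 - v)) (/ x ^ 2) 0 0 t C).
    replace (/ x ^ 2 * 0 + 0) with 0 in H by ring; rewrite <- H.
    rewrite (Rmult_comm _ (/ x ^ 3) : _ / x ^ 3 = _), <- RInt_Rscal.
    + apply RInt_ext_on; [lra|]; intros r Hr; unfold NEs, NEs'.
      replace (/ x ^ 2 * r + 0) with (r / x ^ 2) by (unfold Rdiv; ring).
      replace (c / x ^ 2 - r / x ^ 2) with ((c - r) / x ^ 2) by (unfold Rdiv; ring).
      replace (sqrt x / x ^ 2 * prof (r / x ^ 2) * (sqrt x / x ^ 4 * prof' ((c - r) / x ^ 2)))
        with (sqrt x * sqrt x / x ^ 6 * (prof (r / x ^ 2) * prof' ((c - r) / x ^ 2))) by (field; lra).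
      rewrite sqrt_sqrt by lra; field; lra.
    + apply ex_RInt_cont; intros r; apply cont_mult; [cont|].
      apply (cont_comp (fun v => prof v * prof' (c / x ^ 2 - v))); [cont|apply C].
  - unfold Rdiv; nra.
  - nra.
Qed.

Lemma trace_h_eq kap x t : 0 < x -> 0 < t -> trace_h kap x t = RInt (trace_h_ker kap t x) 0 t.
Proof.
  intros Hx Ht.
  assert (Cf : forall u s, cont2 (fun s u => NEs x (t - s) * (NEs' x (s - u) * M_real kap u)) s u).
  { intros u s; unfold cont2; apply cont_mult.
    - apply (cont_comp (NEs x)); [cont|apply NEs_cont; auto].
    - apply trace_g_ker_cont2; auto. }
  unfold trace_h.
  rewrite (RInt_ext_on (trace_g kap x t) (fun s => RInt (fun u => NEs x (t - s) * (NEs' x (s - u) * M_real kap u)) 0 t)).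
  2: lra.
  2: { intros s _; unfold trace_g; rewrite RInt_Rscal; [reflexivity|].
       apply ex_RInt_cont; intros; apply (cont2_right (fun s u => NEs' x (s - u) * M_real kap u)), trace_g_ker_cont2; auto. }
  rewrite (Fubini (fun s u => NEs x (t - s) * (NEs' x (s - u) * M_real kap u))) by (auto; lra).
  set (G := fun u => RInt (fun s => NEs x (t - s) * (NEs' x (s - u) * M_real kap u)) 0 t).
  (* Reflecting [u = t - c] here and [s = t - r] below turns the factors into [M_real kap (t - c)],
     [NEs x r] and [NEs' x (c - r)]. *)
  rewrite <- (RInt_reflect G).
  2: { intros u; unfold G.
       apply (RInt_param_cont (fun u s => NEs x (t - s) * (NEs' x (s - u) * M_real kap u))); [lra|].
       intros; apply cont2_swap, Cf. }
  apply RInt_ext_on; [lra|]; intros c Hc; unfold G, trace_h_ker.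
  rewrite <- (NEs_conv x t c) by auto.
  rewrite <- RInt_Rscal.
  2: { apply ex_RInt_cont; intros; apply cont_mult; [apply NEs_cont; auto|].
       apply (cont_comp (NEs' x)); [cont|apply NEs'_cont; auto]. }
  rewrite <- RInt_reflect.
  2: { intros s; apply (cont2_left (fun s u => NEs x (t - s) * (NEs' x (s - u) * M_real kap u))), Cf. }
  apply RInt_ext_on; [lra|]; intros r Hr.
  replace (t - (t - r)) with r by ring; replace (t - r - (t - c)) with (c - r) by ring; ring.
Qed.

(** * Integration in [x] and the limits at [0] and [1] *)

Lemma cont2_ratio (g : R -> R) x c : (forall p, continuous g p) -> 0 < x ->
  cont2 (fun x c => g (c / x ^ 2)) x c.
Proof.
  intros Cg Hx; unfold cont2; assert (0 < x ^ 2) by (apply pow_lt; auto).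
  apply (cont_comp g); [cont; cbn [fst snd]; lra|apply Cg].
Qed.

Lemma trace_h_ker_cont2 kap t x c : 0 < x -> cont2 (trace_h_ker kap t) x c.
Proof.
  intros Hx; unfold cont2, trace_h_ker; assert (0 < x ^ 3) by (apply pow_lt; auto).
  apply cont_mult.
  - apply (cont_comp (M_real kap)); [cont|apply M_real_cont].
  - apply cont_div; [cbn [fst snd]; lra|apply (cont2_ratio prof_conv'); auto; apply prof_conv'_cont|cont].
Qed.

Lemma trace_prim_ker_cont2 kap t x c : 0 < x -> cont2 (trace_prim_ker kap t) x c.
Proof.
  intros Hx; unfold cont2, trace_prim_ker; assert (0 < x ^ 2) by (apply pow_lt; auto).
  apply cont_mult.
  - apply (cont_comp (M_real kap)); [cont|apply M_real_cont].
  - apply cont_div; [cbn [fst snd]; lra| |cont].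
    apply cont_mult; [cont|apply (cont2_ratio flat_mean'); auto; apply flat_mean'_cont].
Qed.

Lemma trace_prim_ker_int kap t x a b : 0 < x -> ex_RInt (trace_prim_ker kap t x) a b.
Proof. intros Hx; apply ex_RInt_cont; intros; apply (cont2_right (trace_prim_ker kap t)), trace_prim_ker_cont2; auto. Qed.

Lemma outer_proper kap t a b : 0 < t -> 0 < a <= b ->
  ex_RInt (fun x => trace_h kap x t) a b /\ RInt (fun x => trace_h kap x t) a b = trace_prim kap t a - trace_prim kap t b.
Proof.
  intros Ht Hab; split.
  - apply ex_RInt_ext_on with (fun x => RInt (trace_h_ker kap t (clamp a b x)) 0 t); [lra| |].
    + intros x Hx; rewrite clamp_id by lra; symmetry; apply trace_h_eq; lra.
    + apply ex_RInt_cont; intros x; apply (RInt_param_cont_clamp (trace_h_ker kap t)); [lra|lra|].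
      intros; apply trace_h_ker_cont2; lra.
  - rewrite (RInt_ext_on _ (fun x => RInt (trace_h_ker kap t x) 0 t)) by (try lra; intros; apply trace_h_eq; lra).
    rewrite (Fubini (trace_h_ker kap t)) by (try lra; intros; apply trace_h_ker_cont2; lra).
    unfold trace_prim; rewrite <- RInt_Rminus by (apply trace_prim_ker_int; lra).
    apply RInt_ext_on; [lra|]; intros c Hc.
    (* In this form the derivative in [x] follows from [prof_conv_deriv]; with [flat_mean'] a second
       derivative of [flat_mean] would be required. *)
    assert (HA : forall x, 0 < x -> trace_prim_ker kap t x c = M_real kap (t - c) * (/ 2 * prof_conv (c / x ^ 2) / c)).
    { intros x Hx; assert (0 < x ^ 2) by (apply pow_lt; auto).
      unfold trace_prim_ker; rewrite prof_conv_eq by (apply Rdiv_lt_0_compat; lra); field; lra. }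
    rewrite !HA by lra.
    rewrite (RInt_FTC (fun x => - (M_real kap (t - c) * (/ 2 * prof_conv (c / x ^ 2) / c)))); [|lra| |].
    + ring.
    + intros x Hx; assert (0 < x ^ 2) by (apply pow_lt; lra).
      apply is_derive_ext with (fun x => - (M_real kap (t - c) * / 2 / c) * prof_conv (c / x ^ 2)).
      { intros z; rring. }
      evar_last.
      * apply is_derive_scal, (is_derive_comp prof_conv (fun x => c / x ^ 2)); [apply prof_conv_deriv|].
        auto_derive; [lra|reflexivity].
      * unfold trace_h_ker, scal; simpl; unfold mult; simpl; field; lra.
    + intros x Hx; apply (cont2_left (trace_h_ker kap t)), trace_h_ker_cont2; lra.
Qed.

Section YBounds.
Context (kap t x : R) (Ht : 0 < t) (Hx : 0 < x).

(** The distribution function in [c] whose density appears in [trace_prim_ker]; [trace_prim] is the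
    integral of [M_real kap (t - c)] against it. *)
Let E c := / 2 * flat_mean (c / x ^ 2).

Lemma E_deriv c : is_derive E c (/ 2 * flat_mean' (c / x ^ 2) / x ^ 2).
Proof.
  assert (0 < x ^ 2) by (apply pow_lt; auto); unfold E.
  evar_last.
  - apply is_derive_scal, (is_derive_comp flat_mean (fun c => c / x ^ 2)); [apply flat_mean_deriv|].
    auto_derive; [auto|reflexivity].
  - unfold scal; simpl; unfold mult; simpl; field; lra.
Qed.

Lemma E'_cont c : continuous (fun c => / 2 * flat_mean' (c / x ^ 2) / x ^ 2) c.
Proof.
  assert (0 < x ^ 2) by (apply pow_lt; auto).
  apply cont_div; [lra| |cont]; apply cont_mult; [cont|].
  apply (cont_comp flat_mean'); [cont; lra|apply flat_mean'_cont].
Qed.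

Lemma E_0 : E 0 = 0.
Proof. unfold E; replace (0 / x ^ 2) with 0 by (unfold Rdiv; ring); rewrite flat_mean_0; ring. Qed.

Lemma trace_prim_upper b : (forall c, 0 < c < t -> flat_mean (c / x ^ 2) <= 2 * b) -> trace_prim kap t x <= b * M_real kap t.
Proof.
  intros Hb.
  apply (stieltjes_upper (M_real kap) (K_real kap) (M_real_cont kap) (M_real_deriv kap) E _ E_deriv E'_cont t
    (M_real_0 kap) (K_real_ge0 kap) E_0 ltac:(lra)).
  intros c Hc; unfold E; assert (H := Hb c Hc); lra.
Qed.

Lemma trace_prim_lower a h : 0 <= h <= t -> (forall c, h < c < t -> 2 * a <= flat_mean (c / x ^ 2)) ->
  a * M_real kap (t - h) <= trace_prim kap t x.
Proof.
  intros Hh Ha.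
  apply (stieltjes_lower (M_real kap) (K_real kap) (M_real_cont kap) (M_real_deriv kap) E _ E_deriv E'_cont t
    (M_real_0 kap) (K_real_ge0 kap) E_0 a h); auto.
  - intros c Hc; unfold E; assert (H := flat_mean_ge0 (c / x ^ 2)); lra.
  - intros c Hc; unfold E; assert (H := Ha c Hc); lra.
Qed.

End YBounds.

Lemma M_real_ge0 kap t : 0 <= t -> 0 <= M_real kap t.
Proof.
  intros Ht; rewrite <- (M_real_0 kap); destruct Ht as [Ht|Ht]; [|rewrite Ht; lra].
  apply increasing_deriv with (K_real kap); [lra| | |].
  - intros; apply M_real_deriv; lra.
  - intros; apply M_real_cont.
  - intros; apply K_real_ge0; lra.
Qed.

(** [E <= 1 / 2] everywhere, and [E >= (1 - d) / 2] for [c > h] once [h / x ^ 2 >= P]. So the value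
    lies between [(1 - d) / 2 * M (t - h)] and [M t / 2]; [h] is small by continuity of [M], and [d]
    makes [d * M t <= eps]. *)
Lemma trace_prim_lim0 kap t eps : 0 < t -> 0 < eps ->
  exists del, 0 < del /\ forall x, 0 < x < del -> Rabs (trace_prim kap t x - M_real kap t / 2) < eps.
Proof.
  intros Ht He.
  assert (HM := M_real_ge0 kap t ltac:(lra)).
  destruct (proj1 (cont_eps _ _) (M_real_cont kap t) eps He) as [h0 [Hh0 HC]].
  set (h := Rmin (h0 / 2) t).
  assert (Hh : 0 < h <= t) by (split; [apply Rmin_glb_lt; lra|apply Rmin_r]).
  assert (Hh' : h <= h0 / 2) by apply Rmin_l.
  assert (Hq : 0 < eps / (M_real kap t + 1)) by (apply Rdiv_lt_0_compat; lra).
  set (d := Rmin (1 / 2) (eps / (M_real kap t + 1))).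
  assert (Hd : 0 < d < 1).
  { split; [apply Rmin_glb_lt; lra|]; assert (H := Rmin_l (1 / 2) (eps / (M_real kap t + 1))); fold d in H; lra. }
  assert (Hd' : d * M_real kap t <= eps).
  { assert (H := Rmin_r (1 / 2) (eps / (M_real kap t + 1))); fold d in H.
    apply Rle_trans with (eps / (M_real kap t + 1) * (M_real kap t + 1)); [nra|right; field; lra]. }
  destruct (flat_mean_lim d Hd) as [P [HP HV]].
  assert (Hr : 0 < h / P) by (apply Rdiv_lt_0_compat; lra).
  exists (Rmin 1 (h / P)); split; [apply Rmin_glb_lt; lra|]; intros x Hx.
  assert (L1 := Rmin_l 1 (h / P)); assert (L2 := Rmin_r 1 (h / P)).
  assert (Hx2 : 0 < x ^ 2) by (apply pow_lt; lra).
  assert (Hx2' : x ^ 2 * P <= h).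
  { apply Rle_trans with (h / P * P); [|right; field; lra].
    apply Rmult_le_compat_r; [lra|]; simpl; nra. }
  assert (U := trace_prim_upper kap t x Ht ltac:(lra) (1 / 2)).
  assert (L := trace_prim_lower kap t x ltac:(lra) ((1 - d) / 2) h ltac:(lra)).
  assert (U' : trace_prim kap t x <= 1 / 2 * M_real kap t).
  { apply U; intros c _; assert (H := flat_mean_le1 (c / x ^ 2)); lra. }
  assert (L' : (1 - d) / 2 * M_real kap (t - h) <= trace_prim kap t x).
  { apply L; intros c Hc; replace (2 * ((1 - d) / 2)) with (1 - d) by field; apply HV.
    apply (Rmult_le_reg_r (x ^ 2)); auto; unfold Rdiv; rewrite Rmult_assoc, Rinv_l by lra; lra. }
  assert (Hm : Rabs (M_real kap (t - h) - M_real kap t) < eps).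
  { apply HC; unfold Rminus; rewrite Rplus_comm, <- Rplus_assoc, Rplus_opp_l, Rplus_0_l, Rabs_Ropp, Rabs_pos_eq; lra. }
  apply Rabs_def2 in Hm; apply Rabs_def1; nra.
Qed.

Lemma trace_prim_lim1 kap t eps : 0 < t -> 0 < eps ->
  exists del, 0 < del /\ forall x, 1 - del < x < 1 -> Rabs (trace_prim kap t x - trace_prim kap t 1) < eps.
Proof.
  intros Ht He.
  assert (C := RInt_param_cont_clamp (trace_prim_ker kap t) (1 / 2) 1 0 t 1 ltac:(lra) ltac:(lra)
    ltac:(intros; apply trace_prim_ker_cont2; lra)).
  destruct (proj1 (cont_eps _ _) C eps He) as [d [Hd H]].
  exists (Rmin d (1 / 2)); split; [apply Rmin_glb_lt; lra|]; intros x Hx.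
  assert (L1 := Rmin_l d (1 / 2)); assert (L2 := Rmin_r d (1 / 2)).
  assert (H' := H x ltac:(apply Rabs_def1; lra)).
  rewrite !clamp_id in H' by lra; exact H'.
Qed.

Lemma trace_formula (K : R -> Cplx) kap t :
  (forall u, 0 < u -> K u = RtoC (K_real kap u)) -> 0 < t ->
  Tr1_is K t (RtoC (M_real kap t / 2 - trace_prim kap t 1)).
Proof.
  intros HK Ht.
  exists (fun x s => RtoC (trace_g kap x t s)), (fun x => RtoC (trace_h kap x t)); split; [|split].
  - intros x s Hx Hs; apply inner_integral; auto; lra.
  - intros x Hx; apply middle_integral; lra.
  - set (F := fun x => if Rlt_dec 0 x then - trace_prim kap t x else - (M_real kap t / 2)).
    assert (F0 : F 0 = - (M_real kap t / 2)) by (unfold F; destruct Rlt_dec; lra).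
    assert (Fp : forall x, 0 < x -> F x = - trace_prim kap t x) by (intros; unfold F; destruct Rlt_dec; lra).
    replace (M_real kap t / 2 - trace_prim kap t 1) with (F 1 - F 0) by (rewrite F0, Fp by lra; ring).
    apply (improper_FTC _ (fun x => trace_h kap x t)); [lra|auto| | |].
    + intros a b Ha Hb; rewrite !Fp by lra.
      destruct (outer_proper kap t a b Ht ltac:(lra)) as [E1 E2]; split; auto.
      transitivity (trace_prim kap t a - trace_prim kap t b); [exact E2|rring].
    + intros eps He; destruct (trace_prim_lim0 kap t eps Ht He) as [d [Hd H]].
      exists d; split; auto; intros x Hx Hx'; rewrite F0, Fp by lra.
      replace (- trace_prim kap t x - - (M_real kap t / 2)) with (- (trace_prim kap t x - M_real kap t / 2)) by ring.
      rewrite Rabs_Ropp; apply H; lra.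
    + intros eps He; destruct (trace_prim_lim1 kap t eps Ht He) as [d [Hd H]].
      exists d; split; auto; intros x Hx Hx'; rewrite !Fp by lra.
      replace (- trace_prim kap t x - - trace_prim kap t 1) with (- (trace_prim kap t x - trace_prim kap t 1)) by ring.
      rewrite Rabs_Ropp; apply H; lra.
Qed.

(** This is the cost of cutting the trace at [x = 1]: there [E c <= exp (- 1 / c) / 2 <= exp (- 1 /
    t) / 2]. *)
Lemma trace_prim_1 kap t : 0 < t -> 0 <= trace_prim kap t 1 <= / 2 * exp (- / t) * M_real kap t.
Proof.
  intros Ht; split.
  - assert (H := trace_prim_lower kap t 1 ltac:(lra) 0 0 ltac:(lra)); rewrite Rmult_0_l in H.
    apply H; intros; rewrite Rmult_0_r; apply flat_mean_ge0.
  - apply trace_prim_upper; try lra; intros c Hc; rewrite pow1, Rdiv_1_r.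
    eapply Rle_trans; [apply flat_mean_le; lra|].
    replace (2 * (/ 2 * exp (- / t))) with (exp (- / t)) by field.
    apply exp_le, Ropp_le_contravar, Rinv_le_contravar; lra.
Qed.

(** * Expansion as t tends to 0 *)

Lemma exp_neg_le1 z : 0 <= z -> exp (- z) <= 1.
Proof. intros H; rewrite <- exp_0; apply exp_le; lra. Qed.

(** * The integral over [y > 1] *)

Lemma tail_limit (f : R -> R) t : 0 < t ->
  (forall y, 1 <= y -> continuous f y) ->
  (forall y, 1 <= y -> Rabs (f y) <= exp (- (t * y))) ->
  exists l, forall b, 1 <= b -> Rabs (l - RInt f 1 b) <= / t * exp (- (t * b)).
Proof.
  intros Ht C B; apply cauchy_limit with (om := fun b => / t * exp (- (t * b))); [|apply lim_exp_decay; auto].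
  intros b b' Hb.
  rewrite RInt_diff by (apply ex_RInt_cont_on; [lra|intros; apply C; lra]).
  apply Rle_trans with (RInt (fun y => exp (- (t * y))) b b').
  - apply RInt_abs_le; [lra|apply ex_RInt_cont_on; [lra|intros; apply C; lra]|apply ex_RInt_cont; intros; cont|].
    intros; apply B; lra.
  - rewrite (RInt_FTC (fun y => - / t * exp (- (t * y)))); [|lra| |intros; cont].
    + assert (H1 := exp_pos (- (t * b'))); assert (0 < / t) by (apply Rinv_0_lt_compat; auto); nra.
    + intros; auto_derive; [auto|field; lra].
Qed.

(** The integrand of the statement is [Jre - i PI Jim], so [1 / PI] times the imaginary part of its
    integral is minus the integral of [Jim]. *)
Definition Jre (kap t y : R) := exp (- (t * y)) / y * (ln_shift kap y * weight kap y).
Definition Jim (kap t y : R) := exp (- (t * y)) * (weight kap y / y).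

Lemma J_integrand_eq kap t y : 0 < y -> J_integrand kap t y = (Jre kap t y, - PI * Jim kap t y).
Proof.
  intros Hy; assert (Hp := PI_gt3); unfold J_integrand.
  replace (RtoC y) with (y * cos 0, y * sin 0) by (unfold RtoC; rewrite cos_0, sin_0; f_equal; ring).
  rewrite Clog_polar by lra.
  assert (Hd := den_ge9 (ln_shift kap y)).
  unfold Jre, Jim; rewrite weight_pos by auto.
  unfold Cmul, Cinv, Cadd, RtoC, Ci, ln_shift in *; cbn [fst snd].
  f_equal; field; repeat split; nra.
Qed.

Lemma Jre_cont kap t y : 1 <= y -> continuous (Jre kap t) y.
Proof.
  intros Hy; assert (C1 := weight_cont kap y); assert (C2 := ln_shift_cont kap y ltac:(lra)).
  unfold Jre; cont; lra.
Qed.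

Lemma Jim_cont kap t y : 1 <= y -> continuous (Jim kap t) y.
Proof. intros Hy; assert (C1 := weight_cont kap y); unfold Jim; cont; lra. Qed.

Lemma ln_shift_weight_le1 kap y : 0 < y -> Rabs (ln_shift kap y * weight kap y) <= 1.
Proof.
  intros Hy; assert (Hd := den_ge9 (ln_shift kap y)); rewrite weight_pos by auto.
  rewrite Rabs_mult, (Rabs_pos_eq (/ _)) by (left; apply Rinv_0_lt_compat; lra).
  apply (Rmult_le_reg_r (ln_shift kap y ^ 2 + PI ^ 2)); [lra|].
  rewrite Rmult_assoc, Rinv_l, Rmult_1_r by lra.
  assert (Hp := PI_gt3); rewrite <- (pow2_abs (ln_shift kap y)).
  assert (0 <= (Rabs (ln_shift kap y) - 1) ^ 2) by apply pow2_ge_0; nra.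
Qed.

Lemma Jre_bound kap t y : 1 <= y -> Rabs (Jre kap t y) <= exp (- (t * y)).
Proof.
  intros Hy; unfold Jre, Rdiv; rewrite !Rabs_mult.
  assert (H := ln_shift_weight_le1 kap y ltac:(lra)); rewrite Rabs_mult in H.
  assert (He := exp_pos (- (t * y))); rewrite (Rabs_pos_eq (exp _)) by lra.
  assert (Hi : 0 < / y <= 1) by (split; [apply Rinv_0_lt_compat; lra|rewrite <- Rinv_1; apply Rinv_le_contravar; lra]).
  rewrite (Rabs_pos_eq (/ y)) by lra.
  assert (0 <= Rabs (ln_shift kap y) * Rabs (weight kap y)) by (apply Rmult_le_pos; apply Rabs_pos).
  rewrite Rmult_assoc; apply Rle_trans with (exp (- (t * y)) * 1); [|lra].
  apply Rmult_le_compat_l; [lra|nra].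
Qed.

Lemma weight_div_bound kap y : 1 <= y -> 0 <= weight kap y / y <= 1.
Proof.
  intros Hy; assert (H0 := weight_ge0 kap y); assert (H1 := weight_le1 kap y).
  assert (Hi : 0 < / y <= 1) by (split; [apply Rinv_0_lt_compat; lra|rewrite <- Rinv_1; apply Rinv_le_contravar; lra]).
  unfold Rdiv; nra.
Qed.

Lemma Jim_bound kap t y : 1 <= y -> Rabs (Jim kap t y) <= exp (- (t * y)).
Proof.
  intros Hy; unfold Jim; assert (H := weight_div_bound kap y Hy); assert (He := exp_pos (- (t * y))).
  rewrite Rabs_pos_eq by nra; nra.
Qed.

Lemma J_exists kap t jr ji : 0 < t ->
  (forall b, 1 <= b -> Rabs (jr - RInt (Jre kap t) 1 b) <= / t * exp (- (t * b))) ->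
  (forall b, 1 <= b -> Rabs (ji - RInt (Jim kap t) 1 b) <= / t * exp (- (t * b))) ->
  is_CInt_infty (J_integrand kap t) 1 (jr, - PI * ji).
Proof.
  intros Ht Hr Hi eps He; assert (Hp := PI_gt3); assert (H4 := PI_4).
  assert (L := lim_exp_decay t (/ t) Ht); apply is_lim_spec in L.
  (* The real part counts once and the imaginary part [PI <= 4] times, five sixths of [eps] in
     all. *)
  assert (He5 : 0 < eps / 6) by lra.
  destruct (L (mkposreal _ He5)) as [A HA]; simpl in HA.
  exists (Rmax 1 A); intros b Hb; assert (M1 := Rmax_l 1 A); assert (M2 := Rmax_r 1 A).
  assert (HB := HA b ltac:(lra)); rewrite Rminus_0_r in HB; apply Rabs_def2 in HB.
  assert (IR : ex_RInt (Jre kap t) 1 b) by (apply ex_RInt_cont_on; [lra|intros; apply Jre_cont; lra]).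
  assert (II : ex_RInt (Jim kap t) 1 b) by (apply ex_RInt_cont_on; [lra|intros; apply Jim_cont; lra]).
  exists (RInt (Jre kap t) 1 b, - PI * RInt (Jim kap t) 1 b); split.
  - split; cbn [fst snd]; apply RInt_to_is_RInt.
    + apply ex_RInt_ext_on with (Jre kap t); [lra| |auto].
      intros; rewrite J_integrand_eq by lra; reflexivity.
    + apply RInt_ext_on; [lra|]; intros; rewrite J_integrand_eq by lra; reflexivity.
    + apply ex_RInt_ext_on with (fun y => - PI * Jim kap t y); [lra| |apply ex_RInt_Rscal; auto].
      intros; rewrite J_integrand_eq by lra; reflexivity.
    + rewrite <- RInt_Rscal by auto; apply RInt_ext_on; [lra|].
      intros; rewrite J_integrand_eq by lra; reflexivity.
  - eapply Rle_lt_trans; [apply Cmod_le|]; unfold Csub; cbn [fst snd].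
    assert (B1 := Hr b ltac:(lra)); assert (B2 := Hi b ltac:(lra)).
    rewrite (Rabs_minus_sym _ jr).
    replace (- PI * RInt (Jim kap t) 1 b - - PI * ji) with (PI * (ji - RInt (Jim kap t) 1 b)) by ring.
    rewrite Rabs_mult, (Rabs_pos_eq PI) by lra.
    assert (0 <= Rabs (ji - RInt (Jim kap t) 1 b)) by apply Rabs_pos; nra.
Qed.

(** For [y > 1] the two terms of [1 - exp (- t y)] are integrated separately: the first gives the
    constant [/ 2 - weight_prim kap 1], the second [ji]. *)
Lemma M_real_split kap t ji : 0 < t ->
  (forall b, 1 <= b -> Rabs (ji - RInt (Jim kap t) 1 b) <= / t * exp (- (t * b))) ->
  M_real kap t / 2 = RInt (M_ker kap t) 0 1 / 2 + (/ 2 - weight_prim kap 1) - ji.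
Proof.
  intros Ht Hi; apply Rminus_diag_uniq.
  set (X := M_real kap t / 2 - (RInt (M_ker kap t) 0 1 / 2 + (/ 2 - weight_prim kap 1) - ji)).
  destruct (Req_dec X 0) as [E|E]; auto; exfalso.
  assert (HX := Rabs_pos_lt X E); set (eps := Rabs X) in *.
  assert (L := lim_exp_decay t (/ t) Ht); apply is_lim_spec in L.
  assert (He : 0 < eps / 4) by lra.
  destruct (L (mkposreal _ He)) as [A HA]; simpl in HA.
  destruct (weight_prim_near_half kap (eps / 4) He) as [R0 [HR0 HR]].
  set (R := Rmax R0 (A + 1)).
  assert (M1 := Rmax_l R0 (A + 1)); assert (M2 := Rmax_r R0 (A + 1)); fold R in M1, M2.
  assert (H1 := HR R M1); assert (H2 := HA R ltac:(lra)); rewrite Rminus_0_r in H2; apply Rabs_def2 in H2.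
  assert (B1 := M_real_rate kap t R ltac:(lra) ltac:(lra)); assert (B2 := Hi R ltac:(lra)).
  assert (Cw : forall y, 1 <= y -> continuous (fun y => weight kap y / y) y)
    by (intros y Hy; assert (C1 := weight_cont kap y); cont; lra).
  assert (E1 : M_trunc kap R t = RInt (M_ker kap t) 0 1 + 2 * (weight_prim kap R - weight_prim kap 1 - RInt (Jim kap t) 1 R)).
  { rewrite M_trunc_eq by lra.
    rewrite (RInt_split _ 0 1 R) by (apply M_ker_int; lra); f_equal.
    rewrite <- (RInt_FTC (weight_prim kap) (fun y => weight kap y / y)); [|lra| |].
    2: intros; apply weight_prim_deriv; lra.
    2: intros; apply Cw; lra.
    assert (IJ : ex_RInt (Jim kap t) 1 R) by (apply ex_RInt_cont_on; [lra|intros; apply Jim_cont; lra]).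
    assert (IW : ex_RInt (fun y => weight kap y / y) 1 R) by (apply ex_RInt_cont_on; [lra|intros; apply Cw; lra]).
    rewrite <- RInt_Rminus by auto.
    rewrite <- RInt_Rscal by (apply ex_RInt_Rminus; auto).
    apply RInt_ext_on; [lra|]; intros y Hy; rewrite M_ker_eq by lra; unfold Jim; ring. }
  assert (H3 := weight_prim_lt kap R).
  apply Rabs_le_between in B1; apply Rabs_le_between in B2.
  assert (eps <= eps / 4 + eps / 4 + eps / 4); [|lra].
  unfold eps at 1; apply Rabs_le; unfold X; lra.
Qed.

(** * Taylor expansion of the part [y < 1] *)

Fixpoint tsum (n : nat) (t y : R) : R :=
  match n with
  | O => 0
  | S j => tsum j t y + (-1) ^ j / INR (fact (S j)) * t ^ S j * y ^ j
  end.

Lemma tsum_cont n t y : continuous (tsum n t) y.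
Proof. induction n as [|n IH]; cbn [tsum]; cont. Qed.

(** [tsum n t y] is the Taylor polynomial of [(1 - exp (- t y)) / y] in [t]; this reduces it to that
    of [1 - exp (- z)] at [z = t y]. *)
Lemma tsum_scale n t y : y * tsum n t y = tsum n (t * y) 1.
Proof.
  induction n as [|n IH]; cbn [tsum]; [ring|].
  rewrite Rmult_plus_distr_l, IH, pow1, Rpow_mult_distr; f_equal; cbn [pow]; ring.
Qed.

Lemma pow_fact_deriv n (z : R) :
  is_derive (fun z => z ^ S n / INR (fact (S n))) z (z ^ n / INR (fact n)).
Proof.
  apply is_derive_ext with (fun z => / INR (fact (S n)) * z ^ S n).
  { intros x; apply Rmult_comm. }
  evar_last; [apply is_derive_scal, (is_derive_pow (fun z => z)), is_derive_id|].
  assert (H1 := INR_fact_neq_0 n); assert (H2 : INR (S n) <> 0) by (apply not_0_INR; lia).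
  change (/ INR (fact (S n)) * (INR (S n) * 1 * z ^ n) = z ^ n / INR (fact n)).
  rewrite fact_simpl, mult_INR; field; auto.
Qed.

Lemma tsum_deriv n z : is_derive (fun z => tsum (S n) z 1) z (1 - tsum n z 1).
Proof.
  induction n as [|n IH].
  - assert (H : forall x : R, x = tsum 1 x 1) by (intros x; cbn [tsum]; rewrite pow1; simpl; field).
    apply is_derive_ext with (fun z => z); [exact H|].
    evar_last; [apply is_derive_id|cbn [tsum]; symmetry; apply Rminus_0_r].
  - apply (is_derive_ext (fun z => tsum (S n) z 1 + (-1) ^ S n * (z ^ S (S n) / INR (fact (S (S n)))))).
    { intros x; change (tsum (S (S n)) x 1) with
        (tsum (S n) x 1 + (-1) ^ S n / INR (fact (S (S n))) * x ^ S (S n) * 1 ^ S n).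
      rewrite (pow1 (S n)); rring. }
    evar_last.
    + apply (is_derive_plus (V := R_NormedModule)); [apply IH|apply is_derive_scal, pow_fact_deriv].
    + change (1 - tsum n z 1 + (-1) ^ S n * (z ^ S n / INR (fact (S n))) =
        1 - (tsum n z 1 + (-1) ^ n / INR (fact (S n)) * z ^ S n * 1 ^ n)).
      rewrite pow1; change ((-1) ^ S n) with (-1 * (-1) ^ n); rring.
Qed.

(** The remainders satisfy [D (n + 1)' = - D n] and vanish at 0, so the bound is integrated once per
    step. *)
Lemma exp_taylor_rem n z : 0 <= z -> Rabs (1 - exp (- z) - tsum n z 1) <= z ^ S n / INR (fact (S n)).
Proof.
  revert z; induction n as [|n IH]; intros z Hz.
  - simpl; rewrite Rminus_0_r, Rmult_1_r, Rdiv_1_r.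
    assert (H := exp_ineq1_le (- z)); assert (H' := exp_neg_le1 z Hz).
    rewrite Rabs_pos_eq; lra.
  - set (D := fun n z => 1 - exp (- z) - tsum n z 1) in *.
    assert (CD : forall n v, continuous (D n) v).
    { intros m v; unfold D; apply cont_minus; [cont|].
      destruct m; [cbn [tsum]; cont|].
      apply (cont_deriv _ _ _ (tsum_deriv m v)). }
    assert (E : D (S n) z = RInt (fun v => -1 * D n v) 0 z).
    { rewrite (RInt_FTC (D (S n))); auto.
      - assert (Z : forall m, tsum m 0 1 = 0).
        { induction m as [|m IHm]; [reflexivity|]; cbn [tsum]; rewrite IHm; cbn [pow]; ring. }
        unfold D at 3; rewrite Z, Ropp_0, exp_0; ring.
      - intros v _; unfold D; evar_last.
        + apply (is_derive_minus (V := R_NormedModule)); [|apply tsum_deriv].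
          auto_derive; [auto|reflexivity].
        + unfold minus, plus, opp; simpl; ring.
      - intros; apply cont_mult; [cont|apply CD]. }
    fold (D (S n) z); rewrite E.
    apply Rle_trans with (RInt (fun v => v ^ S n / INR (fact (S n))) 0 z).
    + apply RInt_abs_le; auto.
      * apply ex_RInt_cont; intros; apply cont_mult; [cont|apply CD].
      * apply ex_RInt_cont; intros; cont; apply INR_fact_neq_0.
      * intros v Hv; replace (-1 * D n v) with (- D n v) by ring; rewrite Rabs_Ropp.
        apply IH; lra.
    + right; rewrite (RInt_FTC (fun v => v ^ S (S n) / INR (fact (S (S n))))); auto.
      * rewrite pow_i by lia; rring.
      * intros v _; apply pow_fact_deriv.
      * intros; cont; apply INR_fact_neq_0.
Qed.

(** The constant is the mass of [weight y / y] on [y > 1]; the others are moments of [weight] on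
    [[0, 1]], from the power series of the part [y < 1]. *)
Definition coef (kap : R) (j : nat) : R :=
  match j with
  | O => / 2 - weight_prim kap 1
  | S i => (-1) ^ i / INR (fact (S i)) * RInt (fun y => y ^ i * weight kap y) 0 1
  end.

Fixpoint rsum (b : nat -> R) (t : R) (N : nat) : R :=
  match N with
  | O => 0
  | S n => rsum b t n + b n * t ^ n
  end.

Lemma psum_real b t N : psum (fun n => RtoC (b n)) t N = RtoC (rsum b t N).
Proof.
  induction N as [|N IH]; cbn [psum rsum]; [reflexivity|].
  rewrite IH; unfold Cadd, Cmul, RtoC; cbn [fst snd]; f_equal; ring.
Qed.

Lemma rsum_coef kap t n :
  rsum (coef kap) t (S n) = / 2 - weight_prim kap 1 + RInt (fun y => tsum n t y * weight kap y) 0 1.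
Proof.
  induction n as [|n IH].
  - rewrite (RInt_ext_on _ (fun _ => 0)) by (try lra; intros; cbn [tsum]; ring).
    rewrite RInt_Rconst; cbn [rsum coef pow]; ring.
  - change (rsum (coef kap) t (S (S n))) with (rsum (coef kap) t (S n) + coef kap (S n) * t ^ S n).
    rewrite IH, Rplus_assoc; f_equal; cbn [coef].
    assert (C1 := weight_cont kap).
    replace ((-1) ^ n / INR (fact (S n)) * RInt (fun y => y ^ n * weight kap y) 0 1 * t ^ S n)
      with ((-1) ^ n / INR (fact (S n)) * t ^ S n * RInt (fun y => y ^ n * weight kap y) 0 1) by ring.
    rewrite <- RInt_Rscal by (apply ex_RInt_cont; intros; cont).
    rewrite <- RInt_Rplus.
    + apply RInt_ext_on; [lra|]; intros; cbn [tsum]; ring.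
    + apply ex_RInt_cont; intros; apply cont_mult; auto; apply tsum_cont.
    + apply ex_RInt_cont; intros; cont.
Qed.

(** The Taylor remainder carries [(t y) ^ (n + 1)], which absorbs the [1 / y] of [M_ker] and leaves
    [t ^ (n + 1) * y ^ n <= t ^ (n + 1)]. *)
Lemma near_part kap t n : 0 < t ->
  Rabs (RInt (M_ker kap t) 0 1 / 2 - RInt (fun y => tsum n t y * weight kap y) 0 1) <= t ^ S n.
Proof.
  intros Ht.
  assert (I1 : ex_RInt (M_ker kap t) 0 1) by (apply M_ker_int; lra).
  assert (I2 : ex_RInt (fun y => tsum n t y * weight kap y) 0 1)
    by (apply ex_RInt_cont; intros; apply cont_mult; [apply tsum_cont|apply weight_cont]).
  unfold Rdiv; rewrite Rmult_comm, <- RInt_Rscal, <- RInt_Rminus by (auto; apply ex_RInt_Rscal; auto).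
  apply Rle_trans with ((1 - 0) * t ^ S n); [|lra].
  apply RInt_abs_le_const; [lra|apply ex_RInt_Rminus; auto; apply ex_RInt_Rscal; auto|].
  intros y Hy; rewrite M_ker_eq by lra.
  replace (/ 2 * (2 * (1 - exp (- (t * y))) * (weight kap y / y)) - tsum n t y * weight kap y)
    with ((1 - exp (- (t * y)) - y * tsum n t y) * (weight kap y / y)) by (field; lra).
  rewrite tsum_scale, Rabs_mult.
  assert (Hty : 0 <= t * y) by nra.
  assert (B := exp_taylor_rem n (t * y) Hty).
  assert (Hf : 1 <= INR (fact (S n))) by (apply (le_INR 1), lt_O_fact).
  assert (HW : 0 <= weight kap y / y <= / y).
  { assert (H0 := weight_ge0 kap y); assert (H1 := weight_le1 kap y).
    assert (0 < / y) by (apply Rinv_0_lt_compat; lra); unfold Rdiv; nra. }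
  rewrite (Rabs_pos_eq (weight kap y / y)) by lra.
  assert (Hp : 0 <= (t * y) ^ S n) by (apply pow_le; auto).
  apply Rle_trans with ((t * y) ^ S n * / y).
  - apply Rmult_le_compat; try lra; [apply Rabs_pos|].
    eapply Rle_trans; [apply B|].
    apply (Rmult_le_reg_r (INR (fact (S n)))); [lra|].
    unfold Rdiv; rewrite Rmult_assoc, Rinv_l by lra; nra.
  - rewrite Rpow_mult_distr.
    replace (t ^ S n * y ^ S n * / y) with (t ^ S n * y ^ n) by (cbn [pow]; field; lra).
    assert (0 <= t ^ S n) by (apply pow_le; lra).
    assert (y ^ n <= 1) by (rewrite <- (pow1 n); apply pow_incr; lra); nra.
Qed.

Lemma exp_inv_small N t : 0 < t -> exp (- / t) <= INR (fact N) * t ^ N.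
Proof.
  intros Ht; assert (Hi : 0 < / t) by (apply Rinv_0_lt_compat; auto).
  assert (H := pow_le_exp N (/ t) ltac:(lra)).
  assert (Hf := INR_fact_lt_0 N); assert (Hp : 0 < t ^ N) by (apply pow_lt; auto).
  rewrite exp_Ropp, pow_inv in *.
  replace (INR (fact N) * t ^ N) with (/ (/ t ^ N / INR (fact N))) by (field; lra).
  apply Rinv_le_contravar; auto; apply Rdiv_lt_0_compat; auto; apply Rinv_0_lt_compat; auto.
Qed.

(** In the constant, 1 comes from [near_part]; the rest bounds the cut-off error through
    [exp (- 1 / t) <= (n + 1)! t ^ (n + 1)] and [M t <= M 1]. *)
Lemma expansion_bound kap n t ji : 0 < t < 1 ->
  (forall b, 1 <= b -> Rabs (ji - RInt (Jim kap t) 1 b) <= / t * exp (- (t * b))) ->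
  Rabs (M_real kap t / 2 - trace_prim kap t 1 - (rsum (coef kap) t (S n) - ji))
    <= (1 + / 2 * INR (fact (S n)) * M_real kap 1) * t ^ S n.
Proof.
  intros Ht Hi; rewrite (M_real_split kap t ji) by (auto; lra); rewrite rsum_coef.
  assert (B1 := near_part kap t n ltac:(lra)).
  assert (B2 := trace_prim_1 kap t ltac:(lra)).
  assert (B3 := exp_inv_small (S n) t ltac:(lra)).
  assert (B4 := M_real_le kap t 1 ltac:(lra)); assert (B5 := M_real_ge0 kap t ltac:(lra)).
  assert (Hf := INR_fact_lt_0 (S n)); assert (Hp : 0 < t ^ S n) by (apply pow_lt; lra).
  assert (B6 : exp (- / t) * M_real kap t <= INR (fact (S n)) * t ^ S n * M_real kap 1)
    by (apply Rmult_le_compat; auto; left; apply exp_pos).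
  apply Rabs_le_between in B1; apply Rabs_le; lra.
Qed.

Lemma K_lim_unique kap s z : 0 < s -> K_lim kap s z -> z = RtoC (K_real kap s).
Proof.
  intros Hs Hz; assert (HK := K_lim_K_real kap s Hs).
  assert (D : forall eps, 0 < eps -> Rabs (fst z - K_real kap s) < eps /\ Rabs (snd z) < eps).
  { intros eps He; assert (He2 : 0 < eps / 2) by lra.
    destruct (Hz _ He2) as [R1 H1]; destruct (HK _ He2) as [R2 H2].
    set (R := Rmax R1 R2 + 1).
    assert (M1 := Rmax_l R1 R2); assert (M2 := Rmax_r R1 R2).
    destruct (H1 R ltac:(unfold R; lra)) as [w1 [[I1 I1'] C1]].
    destruct (H2 R ltac:(unfold R; lra)) as [w2 [[I2 I2'] C2]].
    apply is_RInt_to_RInt in I1, I1', I2, I2'.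
    assert (A1 := Cmod_fst (Csub w1 z)); assert (A2 := Cmod_fst (Csub w2 (RtoC (K_real kap s)))).
    assert (A3 := Cmod_snd (Csub w1 z)); assert (A4 := Cmod_snd (Csub w2 (RtoC (K_real kap s)))).
    unfold Csub, RtoC in *; cbn [fst snd] in *.
    assert (F1 := Rle_lt_trans _ _ _ A1 C1); assert (F2 := Rle_lt_trans _ _ _ A2 C2).
    assert (F3 := Rle_lt_trans _ _ _ A3 C1); assert (F4 := Rle_lt_trans _ _ _ A4 C2).
    apply Rabs_def2 in F1; apply Rabs_def2 in F2; apply Rabs_def2 in F3; apply Rabs_def2 in F4.
    split; apply Rabs_def1; lra. }
  assert (Z : forall a, (forall eps, 0 < eps -> Rabs a < eps) -> a = 0).
  { intros a Ha; destruct (Req_dec a 0) as [E|E]; auto.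
    assert (H := Ha _ (Rabs_pos_lt a E)); lra. }
  destruct z as [a b]; cbn [fst snd] in D; unfold RtoC; f_equal.
  - apply Rminus_diag_uniq, Z; intros; apply D; auto.
  - apply Z; intros; apply D; auto.
Qed.

Theorem theorem6p2 (gam : R)
  (Hgam : Un_cv (fun n => harm n - ln (INR n)) gam)
  (theta : R) (Htheta : 0 <= theta < PI) (Htheta2 : theta <> PI / 2) :
  (exists K : R -> Cplx, forall s, 0 < s -> K_lim (kappa gam theta) s (K s)) /\
  forall K : R -> Cplx, (forall s, 0 < s -> K_lim (kappa gam theta) s (K s)) ->
  exists b : nat -> Cplx, forall N : nat,
    exists Cst del, 0 < del /\ forall t, 0 < t < del ->
      exists T J, Tr1_is K t T /\
        is_CInt_infty (J_integrand (kappa gam theta) t) 1 J /\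
        Cmod (Csub T (Cadd (psum b t N) (RtoC (/ PI * snd J)))) <= Cst * t ^ N.
Proof.
  set (kap := kappa gam theta); split.
  { exists (fun s => RtoC (K_real kap s)); intros s Hs; apply K_lim_K_real; auto. }
  intros K HK.
  assert (HK' : forall u, 0 < u -> K u = RtoC (K_real kap u))
    by (intros u Hu; apply K_lim_unique; auto).
  exists (fun j => RtoC (coef kap j)); intros N.
  assert (P0 := PI_RGT_0).
  assert (Main : exists Cst, forall t ji, 0 < t < 1 ->
    (forall b, 1 <= b -> Rabs (ji - RInt (Jim kap t) 1 b) <= / t * exp (- (t * b))) ->
    Rabs (M_real kap t / 2 - trace_prim kap t 1 - (rsum (coef kap) t N - ji)) <= Cst * t ^ N).
  (* [expansion_bound] begins at order 1. Order 0 follows from it by moving [coef kap 0] into the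
     constant, since [t < 1]. *)
  { destruct N as [|n].
    - exists ((1 + / 2 * INR (fact 1) * M_real kap 1) + Rabs (coef kap 0)); intros t ji Ht Hi.
      assert (B := expansion_bound kap 0 t ji Ht Hi); cbn [rsum pow] in *.
      assert (B5 := M_real_ge0 kap 1 ltac:(lra)); assert (Hf := INR_fact_lt_0 1).
      assert (Hq : 0 <= / 2 * INR (fact 1) * M_real kap 1) by (apply Rmult_le_pos; lra).
      replace (M_real kap t / 2 - trace_prim kap t 1 - (0 - ji))
        with (M_real kap t / 2 - trace_prim kap t 1 - (0 + coef kap 0 * 1 - ji) + coef kap 0) by ring.
      eapply Rle_trans; [apply Rabs_triang|]; nra.
    - exists (1 + / 2 * INR (fact (S n)) * M_real kap 1); intros; apply expansion_bound; auto. }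
  destruct Main as [Cst HC]; exists Cst, 1; split; [lra|]; intros t Ht.
  destruct (tail_limit (Jre kap t) t ltac:(lra)) as [jr Hr];
    [intros; apply Jre_cont; auto|intros; apply Jre_bound; auto|].
  destruct (tail_limit (Jim kap t) t ltac:(lra)) as [ji Hi];
    [intros; apply Jim_cont; auto|intros; apply Jim_bound; auto|].
  exists (RtoC (M_real kap t / 2 - trace_prim kap t 1)), (jr, - PI * ji); split; [|split].
  - apply trace_formula; auto; lra.
  - apply J_exists; auto; lra.
  - rewrite psum_real, Cmod_re by (unfold Csub, Cadd, RtoC; cbn [fst snd]; ring).
    unfold Csub, Cadd, RtoC; cbn [fst snd].
    replace (/ PI * (- PI * ji)) with (- ji) by (field; lra).
    apply (HC t ji Ht Hi).
Qed.
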